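(* Let $(\mathcal{S},G,\mathfrak{g},\alpha)$ be an operator system dynamical system and let $(\mathcal{C},\rho,\alpha)$ be an $\alpha$-admissible $C^*$-cover. If $\mathcal{J}_{\mathcal{S}}$ is the Shilov ideal of $\mathcal{S}$ in $\mathcal{C}$ and $q:\mathcal{C}\to\mathcal{C}/\mathcal{J}_{\mathcal{S}}$ is the quotient map, then $$\mathcal{S}\rtimes_{\alpha,\lambda}^{(\mathcal{C}/\mathcal{J}_{\mathcal{S}},\,q\circ\rho)}\mathfrak{g}\simeq\mathcal{S}\rtimes_{\alpha,\lambda}^{(\mathcal{C},\rho)}\mathfrak{g}$$ canonically, i.e. $\rho(x)\lambda_g\mapsto(\rho(x)+\mathcal{J}_{\mathcal{S}})\lambda_g$ ($x\in\mathcal{S}$, $g\in\mathfrak{g}$) defines a unital complete order isomorphism. In particular, the reduced crossed product does not depend on the choice of ($\alpha$-admissible) $C^*$-cover.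
   Context: An (operator system) dynamical system $(\mathcal{S},G,\mathfrak{g},\alpha)$ consists of an operator system $\mathcal{S}$, a discrete group $G$, a generating set $\mathfrak{g}$ of $G$ with $\mathfrak{g}^{-1}=\mathfrak{g}$ and $e\in\mathfrak{g}$, and a group homomorphism $\alpha:G\to\mathrm{Aut}(\mathcal{S})$ into the group of unital complete order isomorphisms of $\mathcal{S}$. A $C^*$-cover of $\mathcal{S}$ is a pair $(\mathcal{C},\rho)$ with $\mathcal{C}$ a unital $C^*$-algebra and $\rho:\mathcal{S}\to\mathcal{C}$ a unital complete order embedding with $C^*(\rho(\mathcal{S}))=\mathcal{C}$. It is $\alpha$-admissible, written $(\mathcal{C},\rho,\alpha)$, if there is an action of $G$ on $\mathcal{C}$ by $*$-automorphisms, again denoted $\alpha$, with $\alpha_g\circ\rho=\rho\circ\alpha_g$ for all $g\in G$. The reduced crossed product relative to $(\mathcal{C},\rho)$ is the operator subsystem $\mathcal{S}\rtimes^{(\mathcal{C},\rho)}_{\alpha,\lambda}\mathfrak{g}:=\mathrm{span}\{\rho(a)\lambda_g:a\in\mathcal{S},g\in\mathfrak{g}\}$ of the reduced $C^*$-crossed product $\mathcal{C}\rtimes_{\alpha,\lambda}G$, where $\lambda_g$ are the canonical unitaries. A boundary ideal for $\mathcal{S}$ in $(\mathcal{C},\rho)$ is a closed two-sided ideal $\mathcal{I}$ of $\mathcal{C}$ such that the quotient map $\mathcal{C}\to\mathcal{C}/\mathcal{I}$ restricts to a complete order embedding on $\rho(\mathcal{S})$. The Shilov ideal $\mathcal{J}_{\mathcal{S}}$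 is the boundary ideal containing all boundary ideals; it always exists. One has $\alpha_g(\mathcal{J}_{\mathcal{S}})=\mathcal{J}_{\mathcal{S}}$ for all $g$, and $(\mathcal{C}/\mathcal{J}_{\mathcal{S}},q\circ\rho)$ is $\alpha$-admissible with the induced action $\dot\alpha_g(x+\mathcal{J}_{\mathcal{S}})=\alpha_g(x)+\mathcal{J}_{\mathcal{S}}$; this action is used in forming the left-hand crossed product. *)

(* Defs.v *)
From HB Require Import structures.
From mathcomp Require Import all_boot all_order all_algebra finmap complex ring.
From mathcomp Require Import boolp classical_sets functions reals.
From mathcomp Require Import topology normedtype sequences summability.
Set Implicit Arguments.
Unset Strict Implicit.
Unset Printing Implicit Defensive.
Import Order.TTheory GRing.Theory Num.Theory numFieldNormedType.Exports.
Local Open Scope classical_set_scope.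
Local Open Scope ring_scope.

(* Unital C*-algebras; they are nonzero, as algType requires 1 != 0. The norm is
   a field because algType and normedModType have no common extension in the
   hierarchy. *)
HB.mixin Record isCStarAlgebra (R : realType) A of GRing.Algebra R[i] A := {
  star : A -> A;
  starD : forall x y : A, star (x + y) = star x + star y;
  starZ : forall (k : R[i]) (x : A), star (k *: x) = k^* *: star x;
  starM : forall x y : A, star (x * y) = star y * star x;
  starK : involutive star;
  cnorm : A -> R;
  cnorm_eq0 : forall x : A, cnorm x = 0 -> x = 0;
  cnormD : forall x y : A, cnorm (x + y) <= cnorm x + cnorm y;
  cnormZ : forall (k : R[i]) (x : A), cnorm (k *: x) = complex.Re `|k| * cnorm x;
  cnormM : forall x y : A, cnorm (x * y) <= cnorm x * cnorm y;
  cnorm_star : forall x : A, cnorm (star x * x) = cnorm x ^+ 2;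
  cnorm_complete : forall u : nat -> A,
    (forall e : R, 0 < e -> exists N, forall m n,
       (N <= m)%N -> (N <= n)%N -> cnorm (u m - u n) < e) ->
    exists l : A, forall e : R, 0 < e -> exists N, forall n,
       (N <= n)%N -> cnorm (l - u n) < e
}.

#[short(type="cstarAlgType")]
HB.structure Definition CStarAlgebra (R : realType) :=
  {A of GRing.Algebra R[i] A & isCStarAlgebra R A}.

HB.mixin Record isHilbert (R : realType) H of CompleteNormedModule R[i] H := {
  hdot : H -> H -> R[i];
  hdotDl : forall x y z : H, hdot (x + y) z = hdot x z + hdot y z;
  hdotZl : forall (k : R[i]) (x y : H), hdot (k *: x) y = k * hdot x y;
  hdotC : forall x y : H, hdot y x = (hdot x y)^*;
  hdotE : forall x : H, hdot x x = `|x| ^+ 2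
}.

#[short(type="hilbertType")]
HB.structure Definition Hilbert (R : realType) :=
  {H of CompleteNormedModule R[i] H & isHilbert R H}.

Section CStarTheory.
Variables (R : realType) (A : cstarAlgType R).
Implicit Types x y z : A.

Lemma cnorm0 : cnorm (0 : A) = 0.
Proof. by rewrite -(scale0r (0 : A)) cnormZ normr0 mul0r. Qed.

Lemma cnormN x : cnorm (- x) = cnorm x.
Proof. by rewrite -scaleN1r cnormZ normrN normr1 mul1r. Qed.

Lemma cnorm_ge0 x : 0 <= cnorm x.
Proof.
have := cnormD x (- x); rewrite subrr cnorm0 cnormN -mulr2n.
by rewrite pmulrn_lge0.
Qed.

Lemma cnormB x y : cnorm (x - y) <= cnorm x + cnorm y.
Proof. by rewrite -(cnormN y) cnormD. Qed.

Lemma starB : {morph (@star R A) : x y / x - y}.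
Proof.
move=> x y; apply: (@addIr _ (star y)); rewrite -starD subrK.
by rewrite subrK.
Qed.

Lemma star0 : star (0 : A) = 0.
Proof. by rewrite -(subrr (0 : A)) starB !subrr. Qed.

Lemma star1 : star (1 : A) = 1.
Proof. by rewrite -[LHS]mulr1 -[X in _ * X](starK 1) -starM mulr1 starK. Qed.

Lemma norm_star_le x : cnorm x <= cnorm (star x).
Proof.
have [->|x0] := eqVneq x 0; first by rewrite star0.
have xp : 0 < cnorm x.
  rewrite lt_neqAle cnorm_ge0 andbT eq_sym; apply: contra x0 => /eqP h.
  by apply/eqP/cnorm_eq0.
by rewrite -(ler_pM2r xp) -expr2 -cnorm_star cnormM.
Qed.

Lemma norm_star x : cnorm (star x) = cnorm x.
Proof.
by apply/eqP; rewrite eq_le norm_star_le -{2}(starK x) norm_star_le.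
Qed.

Lemma cnormZhalf x : cnorm (2^-1 *: x) = 2^-1 * cnorm x.
Proof.
rewrite cnormZ ger0_norm ?invr_ge0 ?ler0n//; congr (_ * _).
have -> : (2^-1 : R[i]) = (2^-1)%:C%C by rewrite fmorphV rmorph_nat.
by [].
Qed.

End CStarTheory.

Section Sqrt.
Variables (R : realType) (A : cstarAlgType R) (z : A).
Hypothesis z1 : cnorm z < 1.
Hypothesis zs : star z = z.
Let k := cnorm z.

(* The limit y of this sequence satisfies (1 - y)^2 = 1 - z. *)
Fixpoint sqrt_iter (n : nat) : A :=
  if n is m.+1 then 2^-1 *: (z + sqrt_iter m * sqrt_iter m) else 0.
Local Notation u := sqrt_iter.

Let k0 : 0 <= k. Proof. exact: cnorm_ge0. Qed.
Let h0 : 0 <= 2^-1 :> R. Proof. by rewrite invr_ge0 ler0n. Qed.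
Let hh (a : R) : 2^-1 * (a + a) = a.
Proof. by rewrite -mulr2n -[a *+ 2]mulr_natl mulrA mulVf ?mul1r// pnatr_eq0. Qed.

Lemma sqrt_iter_le n : cnorm (u n) <= k.
Proof.
elim: n => [|n ih]; first by rewrite cnorm0.
rewrite /= cnormZhalf -[leRHS]hh ler_wpM2l//.
apply: (le_trans (cnormD _ _)); rewrite lerD//.
apply: (le_trans (cnormM _ _)); apply: (le_trans (ler_pM _ _ ih ih)) => //; try exact: cnorm_ge0.
by rewrite -[leRHS]mulr1 ler_wpM2l// ltW.
Qed.

Lemma sqrt_iter_step n : cnorm (u n.+1 - u n) <= k ^+ n.
Proof.
elim: n => [|n ih].
  rewrite expr0 subr0 /= mul0r addr0 cnormZhalf.
  apply: (@le_trans _ _ (2^-1 * (1 + 1))); last by rewrite hh.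
  by rewrite ler_wpM2l//; apply: (le_trans (ltW z1)); rewrite lerDl.
have -> : u n.+2 - u n.+1 =
    2^-1 *: (u n.+1 * (u n.+1 - u n) + (u n.+1 - u n) * u n).
  rewrite mulrBr mulrBl addrA subrK [u n.+2]/= [X in _ - X]/= -scalerBr.
  by rewrite [z + _]addrC addrKA.
rewrite cnormZhalf -[leRHS]hh ler_wpM2l//.
apply: (le_trans (cnormD _ _)); rewrite lerD//.
  apply: (le_trans (cnormM _ _)); rewrite exprS ler_pM ?cnorm_ge0//.
  exact: sqrt_iter_le.
apply: (le_trans (cnormM _ _)); rewrite exprSr ler_pM ?cnorm_ge0//.
exact: sqrt_iter_le.
Qed.

Lemma sqrt_iter_dist n m : cnorm (u (n + m)%N - u n) <= k ^+ n / (1 - k).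
Proof.
have k1 : 0 < 1 - k by rewrite subr_gt0.
rewrite ler_pdivlMr//.
suff h : cnorm (u (n + m)%N - u n) * (1 - k) <= k ^+ n - k ^+ (n + m)%N.
  by apply: (le_trans h); rewrite gerBl exprn_ge0.
elim: m => [|m ih]; first by rewrite addn0 !subrr cnorm0 mul0r.
rewrite addnS.
have -> : u (n + m).+1 - u n =
   (u (n + m).+1 - u (n + m)%N) + (u (n + m)%N - u n) by rewrite addrA subrK.
apply: (@le_trans _ _ ((k ^+ (n + m)%N + cnorm (u (n + m)%N - u n)) * (1 - k))).
  rewrite ler_wpM2r ?(ltW k1)//; apply: (le_trans (cnormD _ _)).
  by rewrite lerD2r sqrt_iter_step.
rewrite mulrDl; apply: (@le_trans _ _ (k ^+ (n + m) * (1 - k) + (k ^+ n - k ^+ (n + m)))).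
  by rewrite lerD2l.
by rewrite mulrBr mulr1 -exprSr addrC subrKA.
Qed.

Lemma sqrt_iter_cvg : exists y : A, forall e : R, 0 < e ->
  exists N, forall n, (N <= n)%N -> cnorm (y - u n) < e.
Proof.
have k1 : 0 < 1 - k by rewrite subr_gt0.
apply: cnorm_complete => e e0.
have e2 : 0 < e / 2 / 2 * (1 - k) by rewrite !mulr_gt0// invr_gt0 ltr0n.
have [N hN] : exists N, k ^+ N <= e / 2 / 2 * (1 - k).
  have kn : `|k| < 1 by rewrite ger0_norm.
  have /cvgrPdist_le/(_ _ e2)[N _ /(_ N (leqnn _))]/= := cvg_expr kn.
  by rewrite sub0r normrN ger0_norm ?exprn_ge0// => h; exists N.
have hu n : (N <= n)%N -> cnorm (u n - u N) <= e / 2 / 2.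
  move=> Nn; rewrite -(subnKC Nn); apply: (le_trans (sqrt_iter_dist _ _)).
  by rewrite ler_pdivrMr.
exists N => n m Nn Nm.
have -> : u n - u m = (u n - u N) - (u m - u N).
  by rewrite opprB addrA subrK.
apply: (le_lt_trans (cnormB _ _)).
apply: (le_lt_trans (lerD (hu _ Nn) (hu _ Nm))).
rewrite -splitr.
by rewrite ltr_pdivrMr ?ltr0n// ltr_pMr// ltr1n.
Qed.

Lemma sqrt_iter_star n : star (u n) = u n.
Proof.
elim: n => [|n ih]; first exact: star0.
by rewrite /= starZ starD starM ih zs conj_Creal// ger0_real ?invr_ge0 ?ler0n.
Qed.

Lemma cstar_sqrt : exists b : A, star b = b /\ b * b = 1 - z.
Proof.
have [y hy] := sqrt_iter_cvg.
have norm0_eq (x : A) (M : R) : 0 <= M ->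
    (forall e, 0 < e -> cnorm x <= M * e) -> x = 0.
  move=> M0 h; apply: cnorm_eq0; apply/eqP; rewrite eq_le cnorm_ge0 andbT.
  apply/ler_addgt0Pr => e e0.
  rewrite add0r; have M1 : 0 < M + 1 by rewrite ltr_wpDl.
  apply: (le_trans (h (e / (M + 1)) _)); first by rewrite divr_gt0.
  by rewrite mulrA ler_pdivrMr// mulrC ler_wpM2l ?(ltW e0)// lerDl.
have ys : star y = y.
  apply/eqP; rewrite -subr_eq0; apply/eqP/(norm0_eq _ 2) => [|e e0].
    exact: ler0n.
  have [N /(_ N (leqnn _)) hN] := hy e e0.
  have -> : star y - y = star (y - u N) - (y - u N).
    by rewrite starB sqrt_iter_star opprB addrA subrK.
  apply: (le_trans (cnormB _ _)); rewrite norm_star.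
  by rewrite mulr_natl mulr2n lerD// ltW.
have yf : 2^-1 *: (z + y * y) = y.
  apply/eqP; rewrite -subr_eq0; apply/eqP/(norm0_eq _ (cnorm y + k + 1)) => [|e e0].
    by rewrite !addr_ge0// cnorm_ge0.
  have [N hN] := hy e e0.
  have hN1 := hN N (leqnn _); have hN2 := hN N.+1 (leqnSn _).
  have -> : 2^-1 *: (z + y * y) - y =
      2^-1 *: (y * (y - u N) + (y - u N) * u N) - (y - u N.+1).
    rewrite mulrBr mulrBl addrA subrK opprB addrA; congr (_ - _).
    by rewrite /= -scalerDr [z + u N * _]addrC addrA subrK addrC.
  apply: (le_trans (cnormB _ _)); rewrite [leRHS]mulrDl mul1r lerD//; last exact: ltW.
  rewrite cnormZhalf [leRHS]mulrDl -[leRHS]hh.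
  have b1 : cnorm (y * (y - u N)) <= cnorm y * e + k * e.
    apply: (le_trans (cnormM _ _)); rewrite -[leLHS]addr0 lerD ?mulr_ge0 ?(ltW e0)//.
    by rewrite ler_wpM2l ?cnorm_ge0// ltW.
  have b2 : cnorm ((y - u N) * u N) <= cnorm y * e + k * e.
    apply: (le_trans (cnormM _ _)); rewrite -[leLHS]add0r lerD ?mulr_ge0 ?(ltW e0) ?cnorm_ge0//.
    by rewrite mulrC ler_pM ?cnorm_ge0 ?sqrt_iter_le// ltW.
  by rewrite ler_wpM2l//; apply: (le_trans (cnormD _ _)); rewrite lerD.
exists (1 - y); split; first by rewrite starB star1 ys.
have yy : z + y * y = y + y.
  by rewrite -{3 4}yf -scalerDl -div1r -mulrDl -mulr2n divff ?scale1r ?pnatr_eq0.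
have -> : z = y + y - y * y by rewrite -yy addrK.
by rewrite mulrBr mulr1 mulrBl mul1r !opprB opprD !addrA [1 - y + _]addrAC.
Qed.
End Sqrt.
Section HilbertTheory.
Variables (R : realType) (H : hilbertType R).
Implicit Types x y z : H.

Lemma hdotDr x y z : hdot x (y + z) = hdot x y + hdot x z.
Proof. by rewrite hdotC hdotDl rmorphD/= -!hdotC. Qed.

Lemma hdotZr (k : R[i]) x y : hdot x (k *: y) = k^* * hdot x y.
Proof. by rewrite hdotC hdotZl rmorphM/= -hdotC. Qed.

Lemma hdotNl x y : hdot (- x) y = - hdot x y.
Proof. by rewrite -scaleN1r hdotZl mulN1r. Qed.

Lemma hdotNr x y : hdot x (- y) = - hdot x y.
Proof. by rewrite hdotC hdotNl rmorphN/= -hdotC. Qed.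

Lemma hdotBl x y z : hdot (x - y) z = hdot x z - hdot y z.
Proof. by rewrite hdotDl hdotNl. Qed.

Lemma hdotBr x y z : hdot x (y - z) = hdot x y - hdot x z.
Proof. by rewrite hdotDr hdotNr. Qed.

Lemma parallelogram x y :
  `|x + y| ^+ 2 + `|x - y| ^+ 2 = (`|x| ^+ 2 + `|y| ^+ 2) *+ 2.
Proof.
rewrite -!hdotE !hdotDl !hdotDr !hdotNl !hdotNr; ring.
Qed.

Lemma polarization x y : hdot x y = 4^-1 *
  (`|x + y| ^+ 2 - `|x - y| ^+ 2
   + 'i * `|x + 'i *: y| ^+ 2 - 'i * `|x - 'i *: y| ^+ 2).
Proof.
rewrite -!hdotE !hdotDl !hdotDr !hdotNl !hdotNr !hdotZl !hdotZr conjCi.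
have ii : 'i * 'i = -1 :> R[i] by rewrite -expr2 sqrCi.
have f4 : 4 != 0 :> R[i] by rewrite pnatr_eq0.
apply: (mulfI f4); rewrite mulrA divff// mul1r.
move: (hdot x x) (hdot x y) (hdot y x) (hdot y y) => a b c d.
have -> : a + b + (c + d) - (a - b + (- c - - d)) = (b + c) * 2 by ring.
set e := 'i in ii *.
have -> : (b + c) * 2 + e * (a + - e * b + (e * c + e * (- e * d))) -
 e * (a - - e * b + (- (e * c) - - (e * (- e * d)))) =
  (b + c) * 2 + (e * e) * (c - b) * 2 by ring.
rewrite ii; ring.
Qed.
End HilbertTheory.
Local Open Scope complex_scope.

Section ComplexSmall.
Variable R : realType.
Implicit Types e k : R[i].

Lemma ge0_complexE e : 0 <= e -> exists2 r : R, 0 <= r & e = r%:C.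
Proof.
move=> e0; exists (complex.Re e); first by move: e0; rewrite lecE => /andP[].
by rewrite RRe_real// ger0_real.
Qed.

Lemma gt0_complexE e : 0 < e -> exists2 r : R, 0 < r & e = r%:C.
Proof.
move=> e0; have [r _ er] := ge0_complexE (ltW e0).
by exists r => //; rewrite -ltcR -er.
Qed.
End ComplexSmall.

(* Unital *-representations of A by bounded operators on H. *)
Record starRep (R : realType) (A : cstarAlgType R) (H : hilbertType R) := StarRep {
  rep_fun :> A -> H -> H;
  rep_linear : forall a, linear (rep_fun a);
  rep_continuous : forall a, continuous (rep_fun a);
  repD : forall a b x, rep_fun (a + b) x = rep_fun a x + rep_fun b x;
  repZ : forall (k : R[i]) a x, rep_fun (k *: a) x = k *: rep_fun a x;
  repM : forall a b x, rep_fun (a * b) x = rep_fun a (rep_fun b x);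
  rep1 : forall x, rep_fun 1 x = x;
  rep_star : forall a x y, hdot (rep_fun a x) y = hdot x (rep_fun (star a) y)
}.

Section RepTheory.
Variables (R : realType) (A : cstarAlgType R) (H : hilbertType R).
Variable pi : starRep A H.

Lemma repB a b x : pi (a - b) x = pi a x - pi b x.
Proof. by rewrite -scaleN1r repD repZ scaleN1r. Qed.

Lemma rep_contr_lt1 (a : A) x : cnorm a < 1 -> `|pi a x| <= `|x|.
Proof.
move=> a1.
have z1 : cnorm (star a * a) < 1 by rewrite cnorm_star expr_lt1// cnorm_ge0.
have zs : star (star a * a) = star a * a by rewrite starM starK.
have [b [bs bb]] := cstar_sqrt z1 zs.
rewrite -ler_sqr ?nnegrE ?normr_ge0// -subr_ge0.
have -> : `|x| ^+ 2 - `|pi a x| ^+ 2 = `|pi b x| ^+ 2.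
  rewrite -!hdotE !rep_star -!repM bs bb repB rep1 hdotBr.
  by [].
by rewrite exprn_ge0.
Qed.

Lemma rep_contr (a : A) x : `|pi a x| <= (cnorm a)%:C * `|x|.
Proof.
have [r r0 rE] := ge0_complexE (normr_ge0 x).
have [s s0 sE] := ge0_complexE (normr_ge0 (pi a x)).
rewrite rE sE -rmorphM lecR.
have key t : cnorm a < t -> s <= t * r.
  move=> at_; have t0 : 0 < t by apply: le_lt_trans at_; exact: cnorm_ge0.
  have tC0 : t%:C != 0 by rewrite gt_eqF// ltcR.
  have := @rep_contr_lt1 (t%:C^-1 *: a) x.
  rewrite repZ normrZ sE rE cnormZ normfV gtr0_norm ?ltcR//.
  rewrite -fmorphV -rmorphM lecR/= => h.
  by rewrite -ler_pdivrMl//; apply: h; rewrite mulrC ltr_pdivrMr// mul1r.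
apply/ler_addgt0Pr => e e0.
have r1 : 0 < r + 1 by rewrite ltr_wpDl.
apply: (le_trans (key (cnorm a + e / (r + 1)) _)).
  by rewrite ltrDl divr_gt0.
rewrite mulrDl lerD2l mulrAC ler_pdivrMr// ler_wpM2l ?(ltW e0)//.
by rewrite lerDl.
Qed.
End RepTheory.
#[export] Existing Instance totally_filter.

Section UnorderedSum.
Variables (R : realType) (G : choiceType).
Implicit Types f : G -> R[i]^o.

Lemma sum_fsubset f (A B : {fset G}) : (forall g, 0 <= f g) -> (A `<=` B)%fset ->
  \sum_(g <- A) f g <= \sum_(g <- B) f g.
Proof.
move=> f0 AB; rewrite (big_fsetID _ (fun g => g \in A) B)/=.
have -> : [fset x | x in B & x \in A]%fset = A.
  by apply/fsetP => x; rewrite !inE/= andb_idl// => /(fsubsetP AB).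
by rewrite lerDl sumr_ge0.
Qed.

Lemma partial_sumE f (A : {fset G}) : partial_sum f A = \sum_(g <- A) f g.
Proof. by rewrite /partial_sum (big_seq_fsetE _ A xpredT f). Qed.

Lemma nonneg_sum f (M : R[i]) : (forall g, 0 <= f g) ->
  (forall A : {fset G}, \sum_(g <- A) f g <= M) ->
  [/\ partial_sum f @ totally --> sum f,
    (forall A : {fset G}, \sum_(g <- A) f g <= sum f) &
    (forall N, (forall A : {fset G}, \sum_(g <- A) f g <= N) -> sum f <= N)].
Proof.
move=> f0 fM.
have s0 (A : {fset G}) : 0 <= \sum_(g <- A) f g by rewrite sumr_ge0.
have sR (A : {fset G}) : \sum_(g <- A) f g = (complex.Re (\sum_(g <- A) f g))%:C.
  by have [r _ ->] := ge0_complexE (s0 A).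
pose E := [set complex.Re (\sum_(g <- A) f g) | A in [set: {fset G}]]%classic.
have hE : has_sup E.
  split; first by exists (complex.Re (\sum_(g <- fset0%fset) f g)); exists fset0%fset.
  exists (complex.Re M) => _ [A _ <-]; have := fM A.
  by rewrite lecE => /andP[].
pose s := (sup E)%:C : R[i]^o.
have les (A : {fset G}) : \sum_(g <- A) f g <= s.
  by rewrite sR lecR; apply: ub_le_sup; [exact: hE.2 | exists A].
have cf : partial_sum f @ totally --> s.
  apply/cvgrPdist_le => _/gt0_complexE[e e0 ->].
  have [_ [A _ <-] hA] := sup_adherent e0 hE.
  exists A => // B /= AB; rewrite partial_sumE.
  rewrite ger0_norm ?subr_ge0 ?les//.
  rewrite lerBlDr -lerBlDl (le_trans _ (sum_fsubset f0 AB))//.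
  by rewrite sR -rmorphB lecR ltW.
have -> : sum f = s by apply/cvg_lim => //; exact: norm_hausdorff.
split=> // N hN.
have [r _ rE] : exists2 r : R, 0 <= r & N = r%:C.
  by apply: ge0_complexE; apply: le_trans (hN fset0%fset).
rewrite rE lecR; apply: ge_sup; first by case: hE.
by move=> _ [A _ <-]; rewrite -lecR -sR -rE.
Qed.

Lemma cvg_sum f l : partial_sum f @ totally --> (l : R[i]^o) -> sum f = l.
Proof. by move=> fl; apply/cvg_lim => //; exact: norm_hausdorff. Qed.

Lemma cvg_partial_sumD f f' l l' :
  partial_sum f @ totally --> (l : R[i]^o) ->
  partial_sum f' @ totally --> (l' : R[i]^o) ->
  partial_sum (fun g => f g + f' g : R[i]^o) @ totally --> (l + l' : R[i]^o).
Proof.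
move=> fl fl'.
have -> : partial_sum (fun g => f g + f' g : R[i]^o) =
    fun A => partial_sum f A + partial_sum f' A.
  by apply/funext => A; rewrite /partial_sum big_split.
exact: (@cvgD R[i] R[i]^o _ _ _ (partial_sum f) (partial_sum f') l l' fl fl').
Qed.

Lemma cvg_partial_sumZ (k : R[i]) f l :
  partial_sum f @ totally --> (l : R[i]^o) ->
  partial_sum (fun g => k *: f g : R[i]^o) @ totally --> (k *: l : R[i]^o).
Proof.
move=> fl.
have -> : partial_sum (fun g => k *: f g : R[i]^o) =
    k \*: partial_sum f.
  by apply/funext => A; rewrite /partial_sum /= scaler_sumr.
exact: (@cvgZl_tmp R[i] R[i]^o _ _ _ k (partial_sum f) l fl).
Qed.

End UnorderedSum.
Arguments cvg_partial_sumZ {R G} k [f l] _.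

Section Ell2.
Variables (R : realType) (G : choiceType) (H : hilbertType R).

(* The subspace l2(G, H) of the space of functions from G to H. *)
Definition sqsummable : {pred G -> H} := fun xi =>
  `[< exists M : R[i], forall A : {fset G}, \sum_(g <- A) `|xi g| ^+ 2 <= M >].

Lemma sqD (x y : H) : `|x + y| ^+ 2 <= (`|x| ^+ 2 + `|y| ^+ 2) *+ 2.
Proof. by rewrite -parallelogram lerDl exprn_ge0. Qed.

Lemma sqsummable_submod_closed : submod_closed sqsummable.
Proof.
split.
  apply/asboolP; exists 0 => A; rewrite big1// => g _.
  by rewrite normr0 expr0n.
move=> k xi eta /asboolP[M hM] /asboolP[N hN]; apply/asboolP.
exists ((`|k| ^+ 2 * M + N) *+ 2) => A.
apply: (@le_trans _ _ (\sum_(g <- A) ((`|k| ^+ 2 * `|xi g| ^+ 2 + `|eta g| ^+ 2) *+ 2))).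
  by apply: ler_sum => g _; rewrite (le_trans (sqD _ _))// normrZ exprMn.
rewrite sumrMnl lerMn2r big_split/=.
apply: lerD; last exact: hN.
by rewrite -mulr_sumr ler_wpM2l// exprn_ge0.
Qed.

HB.instance Definition _ := GRing.isSubmodClosed.Build _ _ sqsummable
  sqsummable_submod_closed.

Record ell2 := Ell2 { ell2_fun :> G -> H; ell2P : ell2_fun \in sqsummable }.

HB.instance Definition _ := [isSub for ell2_fun].
HB.instance Definition _ := [Choice of ell2 by <:].
HB.instance Definition _ := [SubChoice_isSubLmodule of ell2 by <:].

Definition ell2_dot (xi eta : ell2) : R[i] :=
  sum (fun g => hdot (xi g) (eta g) : R[i]^o).

Lemma ell2_sq (xi : ell2) :
  [/\ partial_sum (fun g => `|xi g| ^+ 2 : R[i]^o) @ totally --> (ell2_dot xi xi : R[i]^o),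
    (forall A : {fset G}, \sum_(g <- A) `|xi g| ^+ 2 <= ell2_dot xi xi) &
    (forall N, (forall A : {fset G}, \sum_(g <- A) `|xi g| ^+ 2 <= N) -> ell2_dot xi xi <= N)].
Proof.
have /asboolP[M hM] := ell2P xi.
have E : (fun g => hdot (xi g) (xi g) : R[i]^o) = (fun g => `|xi g| ^+ 2).
  by apply/funext => g; rewrite hdotE.
rewrite /ell2_dot E.
by apply: nonneg_sum hM => g; rewrite exprn_ge0.
Qed.

Lemma ell2_dot_cvg (xi eta : ell2) :
  partial_sum (fun g => hdot (xi g) (eta g) : R[i]^o) @ totally -->
  (ell2_dot xi eta : R[i]^o).
Proof.
suff [l h] : exists l, partial_sum (fun g => hdot (xi g) (eta g) : R[i]^o) @ totally -->
  (l : R[i]^o) by rewrite /ell2_dot (cvg_sum h).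
have [h1 _ _] := ell2_sq (xi + eta).
have [h2 _ _] := ell2_sq (xi - eta).
have [h3 _ _] := ell2_sq (xi + 'i *: eta).
have [h4 _ _] := ell2_sq (xi - 'i *: eta).
have h := cvg_partial_sumZ 4^-1 (cvg_partial_sumD (cvg_partial_sumD
  (cvg_partial_sumD h1 (cvg_partial_sumZ (-1) h2))
  (cvg_partial_sumZ 'i h3)) (cvg_partial_sumZ (- 'i) h4)).
have E : (fun g => hdot (xi g) (eta g) : R[i]^o) = (fun g => 4^-1 *:
    (`|(xi + eta) g| ^+ 2 + -1 *: (`|(xi - eta) g| ^+ 2 : R[i]^o)
     + 'i *: (`|(xi + 'i *: eta) g| ^+ 2 : R[i]^o)
     + - 'i *: (`|(xi - 'i *: eta) g| ^+ 2 : R[i]^o))).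
  by apply/funext => g; rewrite polarization scaleN1r scaleNr.
by rewrite E; eexists; exact: h.
Qed.

Lemma ell2_dotDl (x y z : ell2) : ell2_dot (x + y) z = ell2_dot x z + ell2_dot y z.
Proof.
refine (@eq_trans R[i] _ _ _ _ (cvg_sum (cvg_partial_sumD (@ell2_dot_cvg x z) (@ell2_dot_cvg y z)))).
by rewrite /ell2_dot; apply: (congr1 (fun f : G -> R[i]^o => sum f)); apply/funext => g; exact: hdotDl.
Qed.

Lemma ell2_dotZl (k : R[i]) (x y : ell2) : ell2_dot (k *: x) y = k * ell2_dot x y.
Proof.
refine (@eq_trans R[i] _ _ _ _ (cvg_sum (cvg_partial_sumZ k (@ell2_dot_cvg x y)))).
by rewrite /ell2_dot; apply: (congr1 (fun f : G -> R[i]^o => sum f)); apply/funext => g; exact: hdotZl.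
Qed.

Lemma ell2_dotC (x y : ell2) : ell2_dot y x = (ell2_dot x y)^*%R.
Proof.
apply: cvg_sum; apply/cvgrPdist_le => e e0.
have /cvgrPdist_le/(_ e e0)[A _ hA] := @ell2_dot_cvg x y.
exists A => // B /hA/=; rewrite -[leLHS]norm_conjC rmorphB/=.
rewrite /partial_sum rmorph_sum/=; congr (`|_ - _| <= _).
by apply: eq_bigr => g _; rewrite -hdotC.
Qed.

Lemma ell2_dot_ge0 (x : ell2) : 0 <= ell2_dot x x.
Proof. by have [_ /(_ fset0%fset) + _] := ell2_sq x; rewrite big_seq_fset0. Qed.

Lemma ell2_coord (x : ell2) g : `|x g| ^+ 2 <= ell2_dot x x.
Proof. by have [_ /(_ [fset g]%fset) + _] := ell2_sq x; rewrite big_seq_fset1. Qed.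

Definition ell2_norm (x : ell2) : R[i] := sqrtC (ell2_dot x x).

Lemma ell2_norm_sq x : ell2_norm x ^+ 2 = ell2_dot x x.
Proof. exact: sqrtCK. Qed.

Lemma ell2_norm_ge0 x : 0 <= ell2_norm x.
Proof. by rewrite sqrtC_ge0 ell2_dot_ge0. Qed.

Lemma ell2_norm_le (x : ell2) (M : R[i]) : 0 <= M ->
  (forall A : {fset G}, \sum_(g <- A) `|x g| ^+ 2 <= M ^+ 2) -> ell2_norm x <= M.
Proof.
move=> M0 h; rewrite -ler_sqr ?nnegrE ?ell2_norm_ge0// ell2_norm_sq.
by have [_ _] := ell2_sq x; apply.
Qed.

Lemma ell2_coord_le (x : ell2) g : `|x g| <= ell2_norm x.
Proof.
by rewrite -ler_sqr ?nnegrE ?ell2_norm_ge0// ell2_norm_sq ell2_coord.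
Qed.

Lemma ell2_norm_eq0 x : ell2_norm x = 0 -> x = 0.
Proof.
move=> x0; apply/val_inj/funext => g /=.
by apply/eqP; rewrite -normr_le0 -x0 ell2_coord_le.
Qed.

Lemma ell2_normZ (k : R[i]) x : ell2_norm (k *: x) = `|k| * ell2_norm x.
Proof.
rewrite /ell2_norm ell2_dotZl ell2_dotC ell2_dotZl rmorphM/= -ell2_dotC.
by rewrite mulrA -normCK rootCMl ?exprn_ge0// sqrCK.
Qed.

Lemma ell2_dotDr (x y z : ell2) : ell2_dot x (y + z) = ell2_dot x y + ell2_dot x z.
Proof. by rewrite ell2_dotC ell2_dotDl rmorphD/= -!ell2_dotC. Qed.

Lemma ell2_dotZr (k : R[i]) (x y : ell2) : ell2_dot x (k *: y) = k^*%R * ell2_dot x y.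
Proof. by rewrite ell2_dotC ell2_dotZl rmorphM/= -ell2_dotC. Qed.

Lemma ell2_cauchy_schwarz (x y : ell2) :
  ell2_dot x y + ell2_dot y x <= (ell2_norm x * ell2_norm y) *+ 2.
Proof.
have [x0|x0] := eqVneq (ell2_norm x) 0.
  rewrite x0 mul0r mul0rn (ell2_norm_eq0 x0) -(scale0r (0 : ell2)).
  by rewrite ell2_dotZl ell2_dotZr conjC0 !mul0r addr0.
have [y0|y0] := eqVneq (ell2_norm y) 0.
  rewrite y0 mulr0 mul0rn (ell2_norm_eq0 y0) -(scale0r (0 : ell2)).
  by rewrite ell2_dotZl ell2_dotZr conjC0 !mul0r addr0.
have ab0 : 0 < ell2_norm x * ell2_norm y.
  by rewrite mulr_gt0// lt_neqAle eq_sym ?x0 ?y0 ell2_norm_ge0.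
have aC : (ell2_norm x)^*%R = ell2_norm x by rewrite geC0_conj ?ell2_norm_ge0.
have bC : (ell2_norm y)^*%R = ell2_norm y by rewrite geC0_conj ?ell2_norm_ge0.
have := ell2_dot_ge0 (ell2_norm y *: x + (- ell2_norm x) *: y).
rewrite !(ell2_dotDl, ell2_dotDr, ell2_dotZl, ell2_dotZr) rmorphN/= aC bC.
rewrite -!ell2_norm_sq.
move: (ell2_dot x y) (ell2_dot y x) ab0 => p q.
move: (ell2_norm x) (ell2_norm y) => a b ab0.
rewrite (_ : _ + _ = a * b * ((a * b) *+ 2 - (p + q))); last by ring.
by rewrite pmulr_rge0// subr_ge0.
Qed.

Lemma ell2_normD (x y : ell2) : ell2_norm (x + y) <= ell2_norm x + ell2_norm y.
Proof.
rewrite -ler_sqr ?nnegrE ?addr_ge0 ?ell2_norm_ge0// ell2_norm_sq.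
rewrite ell2_dotDl !ell2_dotDr -!ell2_norm_sq.
have := ell2_cauchy_schwarz x y.
move: (ell2_dot x y) (ell2_dot y x) (ell2_norm x) (ell2_norm y) => p q a b h.
rewrite [leLHS](_ : _ = a ^+ 2 + b ^+ 2 + (p + q)); last by ring.
rewrite [leRHS](_ : _ = a ^+ 2 + b ^+ 2 + (a * b) *+ 2); last by ring.
by rewrite lerD2l.
Qed.

HB.instance Definition _ :=
  Lmodule_isNormed.Build R[i] ell2 ell2_normD ell2_normZ ell2_norm_eq0.

Lemma ell2_complete (F : set_system ell2) : ProperFilter F -> cauchy F -> cvg F.
Proof.
move=> FF cF.
have cg g : cvg ((fun xi : ell2 => xi g) @ F).
  apply/cauchy_cvgP/cauchy_exP => e e0.
  have /cauchyP/(_ e e0)[x0 Fx0] := cF.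
  exists (x0 g).
  suff : F [set xi : ell2 | ball (x0 g) e (xi g)] by [].
  apply: filterS Fx0 => xi; rewrite -!ball_normE/= => h.
  exact: (le_lt_trans (ell2_coord_le (x0 - xi) g) h).
pose l g := lim ((fun xi : ell2 => xi g) @ F).
have Fs (s : seq G) (d : R[i]) : 0 < d ->
    F [set xi : ell2 | forall g, g \in s -> `|l g - xi g| <= d].
  move=> d0; elim: s => [|a s ih]; first by apply: filterE => xi g; rewrite in_nil.
  have /cvgrPdist_le/(_ d d0) Fa := cg a.
  apply: filterS2 Fa ih => xi h1 h2 g; rewrite in_cons.
  by move=> /predU1P[->//|]; exact: h2.
have key (e : R[i]) (x0 : ell2) : 0 < e -> F (ball x0 e) ->
    forall A : {fset G}, \sum_(g <- A) `|x0 g - l g| ^+ 2 <= (e *+ 2) ^+ 2.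
  move=> e0 Fx0 A.
  pose d := e / (#|` A|.+1)%:R.
  have d0 : 0 < d by rewrite divr_gt0// ltr0Sn.
  have FA : F [set xi : ell2 | forall g, g \in A -> `|l g - xi g| <= d].
    exact: Fs.
  have [eta [/= eta1 eta2]] := filter_ex (filterI Fx0 FA).
  apply: (@le_trans _ _ (\sum_(g <- A) (`|(x0 - eta) g| ^+ 2 + d ^+ 2) *+ 2)).
    rewrite big_seq [leRHS]big_seq; apply: ler_sum => g gA.
    have -> : x0 g - l g = (x0 - eta) g + (eta g - l g) by rewrite addrA subrK.
    rewrite (le_trans (sqD _ _))// lerMn2r/= lerD2l ler_sqr ?nnegrE ?(ltW d0)//.
    by rewrite distrC eta2.
  rewrite sumrMnl big_split/= [leRHS](_ : _ = (e ^+ 2 + e ^+ 2) *+ 2); last by ring.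
  rewrite lerMn2r/=; apply: lerD.
    have [_ /(_ A) h _] := ell2_sq (x0 - eta); apply: (le_trans h).
    rewrite -ell2_norm_sq ler_sqr ?nnegrE ?ell2_norm_ge0 ?(ltW e0)//.
    by move: eta1; rewrite -ball_normE/= => /ltW.
  rewrite big_const_seq count_predT iter_addr_0 /d expr_div_n -mulrnAl.
  rewrite ler_pdivrMr ?exprn_gt0 ?ltr0Sn// -mulr_natr ler_wpM2l ?exprn_ge0 ?(ltW e0)//.
  rewrite -natrX ler_nat (leq_trans (leqnSn _))// -[X in (X <= _)%N]expn1.
  by rewrite leq_pexp2l.
have /cauchyP/(_ 1 ltr01)[x1 Fx1] := cF.
have lP : (fun g => x1 g - l g) \in sqsummable.
  by apply/asboolP; eexists; exact: key Fx1.
pose L := x1 - Ell2 lP.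
have LE g : L g = l g by rewrite /= opprB addrC subrK.
apply/cvg_ex; exists L; apply/cvgrPdist_le => e e0.
have e4 : 0 < e / 4 by rewrite divr_gt0.
have /cauchyP/(_ _ e4)[x0 Fx0] := cF.
have h0 : `|x0 - L| <= e / 4 *+ 2.
  apply: ell2_norm_le; first by rewrite mulrn_wge0// ltW.
  move=> A; rewrite (eq_bigr (fun g => `|x0 g - l g| ^+ 2)); first exact: key.
  by move=> g _; rewrite -LE.
apply: filterS Fx0 => xi; rewrite -ball_normE/= => h1.
have -> : L - xi = (x0 - xi) - (x0 - L) by rewrite opprB [RHS]addrC subrKA.
apply: (le_trans (ler_normB _ _)); apply: (le_trans (lerD (ltW h1) h0)).
rewrite -mulrS -[leLHS]mulr_natr mulrAC ler_pdivrMr ?ltr0n// ler_wpM2l ?(ltW e0)//.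
by rewrite ler_nat.
Qed.

HB.instance Definition _ := Uniform_isComplete.Build ell2 ell2_complete.

Lemma ell2_dotE (x : ell2) : ell2_dot x x = `|x| ^+ 2.
Proof. by rewrite -ell2_norm_sq. Qed.

HB.instance Definition _ := isHilbert.Build R ell2
  ell2_dotDl ell2_dotZl ell2_dotC ell2_dotE.

End Ell2.


Definition lspan (R : realType) (V : lmodType R[i]) (A : set V) : set V :=
  [set x | exists n (k : 'I_n -> R[i]) (v : 'I_n -> V),
     (forall i, A (v i)) /\ x = \sum_(i < n) k i *: v i].

(* (adjmx s X)_(i, j) = s (X_(j, i)), the adjoint of X for an involution s. *)
Definition adjmx (V : Type) (s : V -> V) m n (X : 'M[V]_(m, n)) : 'M[V]_(n, m) :=
  map_mx s X^T.

(* Abstract (Choi-Effros) operator systems; os_cone n is the cone of positive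
   elements of M_n(S). *)
HB.mixin Record isOperatorSystem (R : realType) S of GRing.Lmodule R[i] S := {
  os_star : S -> S;
  os_cone : forall n, set 'M[S]_n;
  os_unit : S;
  os_starD : forall x y : S, os_star (x + y) = os_star x + os_star y;
  os_starZ : forall (k : R[i]) (x : S), os_star (k *: x) = k^*%R *: os_star x;
  os_starK : involutive os_star;
  os_cone_herm : forall n (X : 'M[S]_n), os_cone n X -> adjmx os_star X = X;
  os_coneD : forall n (X Y : 'M[S]_n),
    os_cone n X -> os_cone n Y -> os_cone n (X + Y);
  os_cone_compress : forall m n (A : 'M[R[i]]_(n, m)) (X : 'M[S]_n),
    os_cone n X ->
    os_cone m (\matrix_(i < m, j < m)
               \sum_k \sum_l ((A k i)^*%R * A l j) *: X k l);
  os_cone_proper : forall n (X : 'M[S]_n), os_cone n X -> os_cone n (- X) -> X = 0;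
  os_unit_star : os_star os_unit = os_unit;
  os_unit_order : forall n (X : 'M[S]_n), adjmx os_star X = X ->
    exists r : R, os_cone n ((r%:C *: os_unit)%:M + X);
  os_unit_archimedean : forall n (X : 'M[S]_n),
    (forall r : R, 0 < r -> os_cone n ((r%:C *: os_unit)%:M + X)) -> os_cone n X
}.

#[short(type="operatorSystemType")]
HB.structure Definition OperatorSystem (R : realType) :=
  {S of GRing.Lmodule R[i] S & isOperatorSystem R S}.

(* Positive elements of the C*-algebra M_n(A). *)
Definition cstar_cone (R : realType) (A : cstarAlgType R) n : set 'M[A]_n :=
  [set X | exists Y : 'M[A]_n, X = adjmx star Y *m Y].

(* Positive elements of M_n(B(K)) = B(K^n); operators on K are represented by
   functions K -> K. *)
Definition op_cone (R : realType) (K : hilbertType R) n : set 'M[K -> K]_n :=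
  [set T | forall xi : 'I_n -> K,
     0 <= \sum_i \sum_j hdot (T i j (xi j)) (xi i)].

(* f, restricted to the subspace E of V, is a complete order embedding for the
   matrix orders P on V and Q on W. *)
Record complete_order_embedding (R : realType) (V W : lmodType R[i])
    (P : forall n, set 'M[V]_n) (Q : forall n, set 'M[W]_n)
    (E : set V) (f : V -> W) : Prop := CompleteOrderEmbedding {
  coe_linear : forall (k : R[i]) x y, E x -> E y ->
    f (k *: x + y) = k *: f x + f y;
  coe_inj : forall x y, E x -> E y -> f x = f y -> x = y;
  coe_cone : forall n (X : 'M[V]_n), (forall i j, E (X i j)) ->
    P n X <-> Q n (map_mx f X)
}.

Record complete_order_iso (R : realType) (V W : lmodType R[i])
    (P : forall n, set 'M[V]_n) (Q : forall n, set 'M[W]_n)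
    (E : set V) (F : set W) (f : V -> W) : Prop := CompleteOrderIso {
  coi_coe : complete_order_embedding P Q E f;
  coi_onto : f @` E = F
}.

Definition os_automorphism (R : realType) (S : operatorSystemType R)
    (phi : S -> S) : Prop :=
  complete_order_iso (@os_cone R S) (@os_cone R S) setT setT phi /\
  phi os_unit = os_unit.

Definition generates (G : groupType) (A : set G) : Prop :=
  forall K : set G, K 1%g -> (forall x y, K x -> K y -> K (x * y)%g) ->
    (forall x, K x -> K x^-1%g) -> A `<=` K -> K = setT.

Record dynamicalSystem (R : realType) (S : operatorSystemType R)
    (G : groupType) := DynamicalSystem {
  ds_gen : set G;
  ds_genP : generates ds_gen;
  ds_genV : [set g^-1%g | g in ds_gen] = ds_gen;
  ds_gen1 : ds_gen 1%g;
  ds_act :> G -> S -> S;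
  ds_act_aut : forall g, os_automorphism (ds_act g);
  ds_act1 : forall x, ds_act 1%g x = x;
  ds_actM : forall g h x, ds_act (g * h)%g x = ds_act g (ds_act h x)
}.

Record star_morphism (R : realType) (A B : cstarAlgType R) (f : A -> B) :
    Prop := StarMorphism {
  star_morphism_linear : linear f;
  star_morphism_monoid : monoid_morphism f;
  star_morphism_star : forall x, f (star x) = star (f x)
}.

Record cstarAction (R : realType) (G : groupType) (A : cstarAlgType R) :=
    CStarAction {
  ca_act :> G -> A -> A;
  ca_morphism : forall g, star_morphism (ca_act g);
  ca_act1 : forall x, ca_act 1%g x = x;
  ca_actM : forall g h x, ca_act (g * h)%g x = ca_act g (ca_act h x)
}.

Section Covers.
Variables (R : realType) (S : operatorSystemType R).

Definition norm_closed (A : cstarAlgType R) (B : set A) : Prop :=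
  forall x, (forall e : R, 0 < e -> exists2 y, B y & cnorm (x - y) < e) -> B x.

Record closed_star_subalgebra (A : cstarAlgType R) (B : set A) : Prop :=
    ClosedStarSubalgebra {
  css1 : B 1;
  cssD : forall x y, B x -> B y -> B (x + y);
  cssZ : forall (k : R[i]) x, B x -> B (k *: x);
  cssM : forall x y, B x -> B y -> B (x * y);
  css_star : forall x, B x -> B (star x);
  css_closed : norm_closed B
}.

Record cstar_cover (C : cstarAlgType R) (rho : S -> C) : Prop := CStarCover {
  cover_coe :
    complete_order_embedding (@os_cone R S) (@cstar_cone R C) setT rho;
  cover_unit : rho os_unit = 1;
  cover_generates : forall B : set C,
    closed_star_subalgebra B -> range rho `<=` B -> B = setT
}.

Record closed_ideal (C : cstarAlgType R) (I : set C) : Prop := ClosedIdeal {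
  ci0 : I 0;
  ciD : forall x y, I x -> I y -> I (x + y);
  ciMl : forall a x, I x -> I (a * x);
  ciMr : forall a x, I x -> I (x * a);
  ci_closed : norm_closed I
}.

(* (D, q) is the quotient C*-algebra C / I with its quotient map; the quotient
   is determined by this up to a unique *-isomorphism, which is isometric. *)
Record quotient_map (C D : cstarAlgType R) (I : set C) (q : C -> D) : Prop :=
    QuotientMap {
  qm_morphism : star_morphism q;
  qm_surj : forall y, exists x, q x = y;
  qm_ker : forall x, q x = 0 <-> I x
}.

Definition boundary_ideal (C : cstarAlgType R) (rho : S -> C) (I : set C) :
    Prop :=
  closed_ideal I /\
  exists (D : cstarAlgType R) (q : C -> D), quotient_map I q /\
    complete_order_embedding (@cstar_cone R C) (@cstar_cone R D) (range rho) q.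

Definition shilov_ideal (C : cstarAlgType R) (rho : S -> C) (J : set C) :
    Prop :=
  boundary_ideal rho J /\ forall I, boundary_ideal rho I -> I `<=` J.

End Covers.

Definition admissible (R : realType) (S : operatorSystemType R) (G : groupType)
    (X : dynamicalSystem S G) (C : cstarAlgType R) (rho : S -> C)
    (alpha : cstarAction G C) : Prop :=
  forall g x, alpha g (rho x) = rho (X g x).

Definition faithful (R : realType) (A : cstarAlgType R) (H : hilbertType R)
  (pi : starRep A H) : Prop := injective (pi : A -> H -> H).

Section RegularRepresentation.
Variables (R : realType) (G : groupType) (C : cstarAlgType R).
Variables (alpha : cstarAction G C) (H : hilbertType R) (pi : starRep C H).

Section RepAct.
Variable g : G.
Let rho a := pi (alpha g a).

Lemma rep_act_linear a : linear (rho a). Proof. exact: rep_linear. Qed.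

Lemma rep_act_continuous a : continuous (rho a).
Proof. exact: rep_continuous. Qed.

Lemma rep_actD a b x : rho (a + b) x = rho a x + rho b x.
Proof.
have /(_ 1 a b) := star_morphism_linear (ca_morphism alpha g).
by rewrite !scale1r /rho => ->; rewrite repD.
Qed.

Lemma rep_actZ (k : R[i]) a x : rho (k *: a) x = k *: rho a x.
Proof.
have lin := star_morphism_linear (ca_morphism alpha g).
have a0 : alpha g 0 = 0.
  have h := lin 1 0 0; rewrite !scale1r addr0 in h.
  by apply: (@addrI _ (alpha g 0)); rewrite addr0.
have := lin k a 0; rewrite !addr0 a0 addr0 /rho => ->.
by rewrite repZ.
Qed.

Lemma rep_actM a b x : rho (a * b) x = rho a (rho b x).
Proof.
have [_ mul] := star_morphism_monoid (ca_morphism alpha g).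
by rewrite /rho mul repM.
Qed.

Lemma rep_act1 x : rho 1 x = x.
Proof.
have [one _] := star_morphism_monoid (ca_morphism alpha g).
by rewrite /rho one rep1.
Qed.

Lemma rep_act_star a x y : hdot (rho a x) y = hdot x (rho (star a) y).
Proof. by rewrite /rho (star_morphism_star (ca_morphism alpha g)) rep_star. Qed.

Definition rep_act : starRep C H := StarRep rep_act_linear rep_act_continuous
  rep_actD rep_actZ rep_actM rep_act1 rep_act_star.

End RepAct.

Lemma pi_tilde_subproof (a : C) (xi : ell2 G H) :
  (fun h => pi (alpha h^-1%g a) (xi h)) \in @sqsummable R G H.
Proof.
have /asboolP[M hM] := ell2P xi; apply/asboolP.
exists ((cnorm a)%:C ^+ 2 * M) => A.
have a0 : 0 <= (cnorm a)%:C by rewrite ler0c cnorm_ge0.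
apply: (@le_trans _ _ (\sum_(h <- A) (cnorm a)%:C ^+ 2 * `|xi h| ^+ 2)).
  apply: ler_sum => h _; rewrite -exprMn ler_sqr ?nnegrE ?mulr_ge0//.
  exact: (rep_contr (rep_act h^-1%g)).
by rewrite -mulr_sumr ler_wpM2l// exprn_ge0.
Qed.

(* (pi~(a) xi)(h) = pi (alpha_h^-1 (a)) (xi h) *)
Definition pi_tilde (a : C) : ell2 G H -> ell2 G H :=
  fun xi => Ell2 (pi_tilde_subproof a xi).

Lemma lambda_subproof (g : G) (xi : ell2 G H) :
  (fun h => xi (g^-1 * h)%g) \in @sqsummable R G H.
Proof.
have /asboolP[M hM] := ell2P xi; apply/asboolP; exists M => A.
have := hM [fset (g^-1 * h)%g | h in A]%fset.
by rewrite big_imfset//= => x y _ _; exact: mulgI.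
Qed.

(* (lambda_g xi)(h) = xi (g^-1 h) *)
Definition lambda (g : G) : ell2 G H -> ell2 G H :=
  fun xi => Ell2 (lambda_subproof g xi).

Definition op_closure (K : hilbertType R) (E : set (K -> K)) : set (K -> K) :=
  [set T | forall e : R, 0 < e ->
     exists2 T', E T' & forall xi, `|T xi - T' xi| <= e%:C * `|xi|].

(* The reduced C*-crossed product, as a C*-algebra of operators on l2(G, H). *)
Definition reduced_cstar_crossed_product : set (ell2 G H -> ell2 G H) :=
  op_closure
    (lspan [set T | exists a g, T = pi_tilde a \o lambda g]).

Definition reduced_crossed_product (S : operatorSystemType R)
    (X : dynamicalSystem S G) (rho : S -> C) : set (ell2 G H -> ell2 G H) :=
  lspan [set T | exists (x : S) (g : G),
    ds_gen X g /\ T = pi_tilde (rho x) \o lambda g].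

Lemma sub_reduced_crossed_product (S : operatorSystemType R)
    (X : dynamicalSystem S G) (rho : S -> C) :
  reduced_crossed_product X rho `<=` reduced_cstar_crossed_product.
Proof.
move=> _ [n [k [v [hv ->]]]] e e0; eexists.
  exists n, k, v; split=> [i|]; last by [].
  by have [x [g [_ ->]]] := hv i; exists (rho x), g.
by move=> xi; rewrite subrr normr0 mulr_ge0// ler0c ltW.
Qed.

End RegularRepresentation.

(* The assignment rho1(x) lambda_g |-> rho2(x) lambda_g (x in S, g in the
   generating set) defines a unital complete order isomorphism between the
   reduced crossed products relative to (C1, rho1) and (C2, rho2), realized on
   l2(G, H1) and l2(G, H2). *)
Definition canonically_isomorphic (R : realType) (S : operatorSystemType R)
    (G : groupType) (X : dynamicalSystem S G)
    (C1 : cstarAlgType R) (rho1 : S -> C1) (alpha1 : cstarAction G C1)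
    (H1 : hilbertType R) (pi1 : starRep C1 H1)
    (C2 : cstarAlgType R) (rho2 : S -> C2) (alpha2 : cstarAction G C2)
    (H2 : hilbertType R) (pi2 : starRep C2 H2) : Prop :=
  exists Phi : (ell2 G H1 -> ell2 G H1) -> (ell2 G H2 -> ell2 G H2),
    [/\ complete_order_iso (@op_cone R (ell2 G H1)) (@op_cone R (ell2 G H2))
          (reduced_crossed_product alpha1 pi1 X rho1)
          (reduced_crossed_product alpha2 pi2 X rho2) Phi,
        Phi idfun = idfun &
        forall (x : S) (g : G), ds_gen X g ->
          Phi (pi_tilde alpha1 pi1 (rho1 x) \o @lambda R G H1 g) =
          pi_tilde alpha2 pi2 (rho2 x) \o @lambda R G H2 g].

(* Main.v *)
Require Import Defs.
From HB Require Import structures.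
From mathcomp Require Import all_boot all_order all_algebra finmap complex ring.
From mathcomp Require Import boolp classical_sets functions reals.
From mathcomp Require Import topology normedtype sequences summability.

(** Positivity in a reduced crossed product is decided inside S alone, and this
    is why the choice of the cover does not matter.

    On l2(G, H) the operator pi~(rho x) lambda_g has the entry
    pi (alpha_h^-1 (rho x)) at (h, k) when g = h k^-1 and zero elsewhere. By
    admissibility this entry is pi (rho (alpha_h^-1 x)), the image of an element
    of S. A matrix of finite sums of such operators is therefore positive exactly
    when all its finite blocks, indexed by finitely many points of G, are
    positive: finitely supported vectors are dense in l2(G, H) ([trunc_cvg]).
    Each block is a matrix over S pushed through rho and then pi. Since rho is a
    complete order embedding and a faithful representation reflects positivity
    of matrices ([cstar_cone_op_cone]), the block is positive if and only if the
    corresponding matrix over S lies in the cone of S. The outcome is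
    [op_cone_word_op], whose right-hand side mentions neither the cover nor the
    Hilbert space. An operator vanishes when it and its opposite are positive,
    so the same criterion shows that sending rho1(x) lambda_g to rho2(x) lambda_g
    is well defined and injective; it is then a complete order isomorphism
    ([embeddings_canonically_isomorphic]).

    This covers any two admissible covers at once. It also covers the quotient
    by the Shilov ideal J, because J is a boundary ideal: positivity in a
    quotient C*-algebra depends only on the kernel, as a factorization Y* Y lifts
    along the surjection, so any quotient map with kernel J is completely order
    embedding on rho(S) ([boundary_quotient_coe]).

    The analytic input is that a faithful representation of C reflects positivity
    of matrices over C. A self-adjoint c has a modulus h = |c| that is the square
    of a self-adjoint element commuting with c; it is obtained from the iteration
    for 1 - sqrt (1 - z) on the closed unit ball. If pi(c) >= 0, then q = h - c
    satisfies q h q = - q c q. One side is nonnegative and the other nonpositive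
    under pi, so q h q = 0, hence q ^ 3 = 2 q h q = 0, q = 0 and c = |c| is a
    square ([pos_form_sqrt]). Applied to C this shows that pi is isometric
    ([faithful_isometric]), which makes the matrices over C complete for their
    operator norm. They thus form a C*-algebra acting faithfully on H^n, and the
    first argument applies to them. *)

Set Implicit Arguments.
Unset Strict Implicit.
Unset Printing Implicit Defensive.
Import Order.TTheory GRing.Theory Num.Theory numFieldNormedType.Exports.
Local Open Scope classical_set_scope.
Local Open Scope ring_scope.
Local Open Scope complex_scope.

(** * Norm limits in a C*-algebra *)
Section NormLimits.
Variables (R : realType) (A : cstarAlgType R).
Implicit Types (u v : nat -> A) (x y : A).

(** The C*-norm is a field of the structure rather than a canonical norm, so
    convergence in it is spelled out. *)
Definition cnorm_lim u x : Prop :=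
  forall e : R, 0 < e -> exists N, forall n, (N <= n)%N -> cnorm (x - u n) < e.

Lemma cnorm_lim_le u x (v : nat -> R) :
  (forall n, cnorm (x - u n) <= v n) -> v @ \oo --> 0 -> cnorm_lim u x.
Proof.
move=> uv v0 e e0.
have /cvgr0Pnorm_lt/(_ _ e0)[N _ hN] := v0.
exists N => n Nn; apply: le_lt_trans (uv n) _.
by apply: le_lt_trans (hN n Nn); rewrite ler_norm.
Qed.

Lemma cnorm_lim_cvg u x : cnorm_lim u x -> (fun n => cnorm (x - u n)) @ \oo --> (0 : R).
Proof.
move=> ux; apply/cvgr0Pnorm_lt => e /ux[N hN].
by exists N => // n /hN; rewrite /= ger0_norm// cnorm_ge0.
Qed.

Lemma cnorm_lim_cst x : cnorm_lim (fun=> x) x.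
Proof. by move=> e e0; exists 0%N => n _; rewrite subrr cnorm0. Qed.

Lemma cnorm_lim_unique u x y : cnorm_lim u x -> cnorm_lim u y -> x = y.
Proof.
move=> /cnorm_lim_cvg ux /cnorm_lim_cvg uy.
apply/eqP; rewrite -subr_eq0; apply/eqP/cnorm_eq0.
have h : (fun=> cnorm (x - y)) @ \oo --> (0 : R).
  apply: (@squeeze_cvgr _ _ _ _ (fun=> 0)
    (fun n => cnorm (x - u n) + cnorm (y - u n))); last 2 first.
  - exact: cvg_cst.
  - by rewrite -[0 in X in _ --> X]addr0; exact: cvgD.
  apply: nearW => n; rewrite cnorm_ge0/=.
  by rewrite (_ : x - y = x - u n - (y - u n)) ?cnormB// opprB addrA subrK.
by rewrite -(cvg_lim _ h)// lim_cst.
Qed.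

Lemma cnorm_limS u x : cnorm_lim u x -> cnorm_lim (fun n => u n.+1) x.
Proof.
by move=> ux e /ux[N hN]; exists N => n Nn; apply: hN; rewrite leqW.
Qed.

Lemma cnorm_limD u v x y : cnorm_lim u x -> cnorm_lim v y ->
  cnorm_lim (fun n => u n + v n) (x + y).
Proof.
move=> /cnorm_lim_cvg ux /cnorm_lim_cvg vy.
apply: (@cnorm_lim_le _ _ (fun n => cnorm (x - u n) + cnorm (y - v n))).
  by move=> n; rewrite opprD addrACA cnormD.
by rewrite -[0 in X in _ --> X]addr0; exact: cvgD.
Qed.

Lemma cnorm_limZ (k : R[i]) u x : cnorm_lim u x ->
  cnorm_lim (fun n => k *: u n) (k *: x).
Proof.
move=> /cnorm_lim_cvg ux.
apply: (@cnorm_lim_le _ _ (fun n => complex.Re `|k| * cnorm (x - u n))).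
  by move=> n; rewrite -scalerBr cnormZ.
by rewrite -(mulr0 (complex.Re `|k|)); apply: cvgMl_tmp.
Qed.

Lemma cnorm_lim_star u x : cnorm_lim u x -> cnorm_lim (fun n => star (u n)) (star x).
Proof.
move=> ux e /ux[N hN]; exists N => n /hN.
by rewrite -starB norm_star.
Qed.

Lemma cnorm_limM u v x y : cnorm_lim u x -> cnorm_lim v y ->
  cnorm_lim (fun n => u n * v n) (x * y).
Proof.
move=> /cnorm_lim_cvg ux /cnorm_lim_cvg vy.
apply: (@cnorm_lim_le _ _ (fun n => cnorm x * cnorm (y - v n) +
   cnorm (x - u n) * (cnorm y + cnorm (y - v n)))).
  move=> n.
  have -> : x * y - u n * v n = x * (y - v n) + (x - u n) * v n.
    by rewrite mulrBr mulrBl addrA subrK.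
  have vn : cnorm (v n) <= cnorm y + cnorm (y - v n).
    by rewrite -{1}(subKr y (v n)) cnormB.
  apply: (le_trans (cnormD _ _)); rewrite lerD ?cnormM//.
  by apply: (le_trans (cnormM _ _)); rewrite ler_wpM2l ?cnorm_ge0.
have h0 : 0 = cnorm x * 0 + 0 * (cnorm y + 0) :> R by rewrite !mul0r mulr0 !addr0.
rewrite [X in _ --> X]h0; apply: cvgD; first exact: cvgMl_tmp.
by apply: cvgM => //; apply: cvgD => //; exact: cvg_cst.
Qed.

Lemma cnorm_lim_le_norm u x (M : R) : cnorm_lim u x ->
  (forall n, cnorm (u n) <= M) -> cnorm x <= M.
Proof.
move=> ux uM; apply/ler_addgt0Pr => e e0.
have [N /(_ _ (leqnn N)) hN] := ux e e0.
rewrite -(subrK (u N) x) addrC; apply: le_trans (cnormD _ _) _.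
by rewrite lerD// ltW.
Qed.
End NormLimits.

(** * Square roots and moduli of self-adjoint elements *)

(** The iteration for 1 - sqrt (1 - z) at the scalar z = 1. It dominates the
    iteration at every z in the closed unit ball. *)
Fixpoint sqrt_majorant (R : realType) (n : nat) : R :=
  if n is m.+1 then 2^-1 * (1 + sqrt_majorant R m ^+ 2) else 0.

Section SquareRoot.
Variables (R : realType) (A : cstarAlgType R).
Local Notation s := (sqrt_majorant R).

Let half (a : R) : 2^-1 * (a + a) = a.
Proof. by rewrite -mulr2n -[a *+ 2]mulr_natl mulrA mulVf ?mul1r// pnatr_eq0. Qed.

Let half0 : 0 <= 2^-1 :> R. Proof. by rewrite invr_ge0 ler0n. Qed.

Lemma sqrt_majorant_01 n : 0 <= s n <= 1.
Proof.
elim: n => [|n /andP[s0 s1]] /=; first by rewrite lexx ler01.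
rewrite mulr_ge0 ?addr_ge0 ?exprn_ge0//= -[leRHS]half ler_wpM2l// lerD2l.
by rewrite exprn_ile1.
Qed.

Lemma sqrt_majorantS n :
  s n.+2 - s n.+1 = 2^-1 * (s n.+1 + s n) * (s n.+1 - s n).
Proof.
have E k : s k.+1 = 2^-1 * (1 + s k ^+ 2) by [].
by rewrite (E n.+1) [X in _ - X = _](E n); ring.
Qed.

Lemma sqrt_majorant_nondecreasing : nondecreasing_seq s.
Proof.
apply/nondecreasing_seqP; elim=> [|n ih].
  by have /andP[] := sqrt_majorant_01 1.
rewrite -subr_ge0 sqrt_majorantS mulr_ge0 ?subr_ge0// mulr_ge0//.
by rewrite addr_ge0//; [have /andP[] := sqrt_majorant_01 n.+1
  | have /andP[] := sqrt_majorant_01 n].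
Qed.

Lemma sqrt_majorant_cvg : cvgn s.
Proof.
apply: nondecreasing_is_cvgn; first exact: sqrt_majorant_nondecreasing.
by exists 1 => _ [n _ <-]; have /andP[] := sqrt_majorant_01 n.
Qed.

Variable z : A.
Hypothesis z1 : cnorm z <= 1.
Hypothesis zs : star z = z.
Local Notation u := (sqrt_iter z).

Lemma sqrt_iter_le_majorant n : cnorm (u n) <= s n.
Proof.
elim: n => [|n ih]; first by rewrite cnorm0.
rewrite /= cnormZhalf ler_wpM2l//; apply: (le_trans (cnormD _ _)).
by rewrite lerD// (le_trans (cnormM _ _))// expr2 ler_pM ?cnorm_ge0.
Qed.

Lemma sqrt_iter_le1 n : cnorm (u n) <= 1.
Proof.
by apply: le_trans (sqrt_iter_le_majorant n) _; have /andP[] := sqrt_majorant_01 n.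
Qed.

(** Both iterations satisfy the recursion
    a_(n+2) - a_(n+1) = (a_(n+1) (a_(n+1) - a_n) + (a_(n+1) - a_n) a_n) / 2, so
    the domination passes to the increments. The increments of the scalar
    iteration telescope, hence the iteration at z is Cauchy even if the norm of z
    is 1, where no geometric bound is available. *)
Lemma sqrt_iter_step_majorant n : cnorm (u n.+1 - u n) <= s n.+1 - s n.
Proof.
elim: n => [|n ih].
  by rewrite !subr0 sqrt_iter_le_majorant.
have -> : u n.+2 - u n.+1 =
    2^-1 *: (u n.+1 * (u n.+1 - u n) + (u n.+1 - u n) * u n).
  rewrite mulrBr mulrBl addrA subrK [u n.+2]/= [X in _ - X]/= -scalerBr.
  by rewrite [z + _]addrC addrKA.
rewrite cnormZhalf sqrt_majorantS -mulrA ler_wpM2l//.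
rewrite [leRHS]mulrDl; apply: (le_trans (cnormD _ _)); rewrite lerD//.
  by apply: (le_trans (cnormM _ _)); rewrite ler_pM ?cnorm_ge0// sqrt_iter_le_majorant.
apply: (le_trans (cnormM _ _)); rewrite mulrC.
by rewrite ler_pM ?cnorm_ge0// sqrt_iter_le_majorant.
Qed.

Lemma sqrt_iter_dist_majorant n m : (n <= m)%N ->
  cnorm (u m - u n) <= s m - s n.
Proof.
move=> /subnKC <-; elim: (m - n)%N => [|k ih]; first by rewrite addn0 !subrr cnorm0.
rewrite addnS -(subrKA (u (n + k)%N)) -(subrKA (s (n + k)%N)).
apply: (le_trans (cnormD _ _)); rewrite lerD//.
exact: sqrt_iter_step_majorant.
Qed.

Lemma sqrt_iter_lim : exists y, cnorm_lim u y.
Proof.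
apply: cnorm_complete => e e0.
have sl := sqrt_majorant_cvg.
have /cvgrPdist_lt/(_ _ e0)[N _ hN] := sl.
have aux n m : (N <= n)%N -> (n <= m)%N -> cnorm (u m - u n) < e.
  move=> Nn nm; apply: le_lt_trans (sqrt_iter_dist_majorant nm) _.
  have := hN n Nn => /=; have h k := nondecreasing_cvgn_le sqrt_majorant_nondecreasing sl k.
  rewrite ger0_norm ?subr_ge0 ?h//; apply: le_lt_trans.
  by rewrite lerD2r h.
exists N => m n Nm Nn; case: (leqP n m) => [|/ltnW] h; first exact: aux.
by rewrite -opprB cnormN; exact: aux.
Qed.

Lemma sqrt_iter_commute w n : w * z = z * w -> w * u n = u n * w.
Proof.
move=> wz; elim: n => [|n ih] /=; first by rewrite mulr0 mul0r.
by rewrite -scalerAr -scalerAl mulrDr mulrDl wz mulrA ih -!mulrA ih.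
Qed.

(** Square roots of 1 - z on the closed unit ball. The bound on y makes 1 - y
    itself of the form to which the lemma applies, which allows taking fourth
    roots; the commutation holds because y is a limit of polynomials in z. *)
Lemma sqrt_one_sub : exists y : A, [/\ star y = y, cnorm y <= 1,
  (1 - y) * (1 - y) = 1 - z & forall w, w * z = z * w -> w * y = y * w].
Proof.
have [y uy] := sqrt_iter_lim; exists y; split.
- apply: (cnorm_lim_unique _ uy).
  have /= := cnorm_lim_star uy; congr cnorm_lim.
  by apply/funext => n; rewrite sqrt_iter_star.
- exact: (cnorm_lim_le_norm uy sqrt_iter_le1).
- have yf : 2^-1 *: (z + y * y) = y.
    apply: (cnorm_lim_unique _ (cnorm_limS uy)).
    exact: (cnorm_limZ 2^-1 (cnorm_limD (cnorm_lim_cst z) (cnorm_limM uy uy))).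
  have yy : z + y * y = y + y.
    by rewrite -{3 4}yf -scalerDl -div1r -mulrDl -mulr2n divff ?scale1r ?pnatr_eq0.
  have -> : z = y + y - y * y by rewrite -yy addrK.
  by rewrite mulrBr mulr1 mulrBl mul1r !opprB opprD !addrA [1 - y + _]addrAC.
move=> w wz; apply: (@cnorm_lim_unique _ _ (fun n => w * u n)).
  exact: cnorm_limM (cnorm_lim_cst w) uy.
have := cnorm_limM uy (cnorm_lim_cst w); congr cnorm_lim.
by apply/funext => n; rewrite sqrt_iter_commute.
Qed.

End SquareRoot.

Section SelfAdjoint.
Variables (R : realType) (A : cstarAlgType R).
Implicit Types c f g z : A.

Lemma cnorm1 : cnorm (1 : A) = 1.
Proof.
have h := cnorm_star (1 : A); rewrite star1 mulr1 expr2 in h.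
have n0 : cnorm (1 : A) != 0.
  by apply/eqP => /cnorm_eq0/eqP; rewrite oner_eq0.
by apply: (mulfI n0); rewrite mulr1.
Qed.

Lemma cnormZr (k : R) c : 0 <= k -> cnorm (k%:C *: c) = k * cnorm c.
Proof. by move=> k0; rewrite cnormZ ger0_norm// ler0c. Qed.

Lemma starZr (k : R) c : star (k%:C *: c) = k%:C *: star c.
Proof. by rewrite starZ; congr (_ *: _); exact: conjc_real. Qed.

Lemma cnorm_sqr c : star c = c -> cnorm (c * c) = cnorm c ^+ 2.
Proof. by move=> cs; rewrite -cnorm_star cs. Qed.

(** By the C*-identity the fourth power of the norm of c is the norm of the
    fourth power of c. *)
Lemma cube_eq0 c : star c = c -> c * c * c = 0 -> c = 0.
Proof.
move=> cs c3; apply: cnorm_eq0; apply/eqP.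
have ccs : star (c * c) = c * c by rewrite starM cs.
suff : (cnorm c ^+ 2) ^+ 2 == 0 by rewrite !sqrf_eq0.
by rewrite -!cnorm_sqr// mulrA c3 mul0r cnorm0.
Qed.

(** The element u = f + i g satisfies u* u = k, so its norm is the square root
    of k, and f is its real part. This bound replaces order arguments in the
    C*-algebra. *)
Lemma cnorm_le_sum_sqr f g (k : R) : star f = f -> star g = g -> f * g = g * f ->
  0 <= k -> f * f + g * g = k%:C *: 1 -> cnorm f ^+ 2 <= k.
Proof.
move=> fs gs fg k0 sum_fg; pose u := f + 'i *: g.
have us : star u = f - 'i *: g by rewrite starD starZ fs gs conjCi scaleNr.
have uu : star u * u = k%:C *: 1.
  rewrite us mulrDr !mulrBl -!scalerAl -!scalerAr fg scalerA.
  rewrite -(expr2 'i) sqrCi.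
  by rewrite scaleN1r opprK addrA subrK.
have <- : cnorm u ^+ 2 = k by rewrite -cnorm_star uu cnormZr// cnorm1 mulr1.
rewrite ler_sqr ?nnegrE ?cnorm_ge0//.
have -> : f = 2^-1 *: (u + star u).
  by rewrite us addrACA subrr addr0 -mulr2n -(scaler_nat _ f) scalerA mulVf ?scale1r// pnatr_eq0.
rewrite cnormZhalf ler_pdivrMl ?ltr0n//.
by apply: (le_trans (cnormD _ _)); rewrite norm_star mulr_natl mulr2n.
Qed.

(** With b a square root of 1 - c^2 that commutes with c, b^2 + c^2 = 1. *)
Lemma cnorm_one_sub_sqr c : star c = c -> cnorm c <= 1 -> cnorm (1 - c * c) <= 1.
Proof.
move=> cs c1; have ccs : star (c * c) = c * c by rewrite starM cs.
have cc1 : cnorm (c * c) <= 1 by rewrite cnorm_sqr// exprn_ile1// cnorm_ge0.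
have [y [ys _ yE yC]] := sqrt_one_sub cc1 ccs.
have bs : star (1 - y) = 1 - y by rewrite starB star1 ys.
rewrite -yE cnorm_sqr//.
apply: (@cnorm_le_sum_sqr _ c) => //.
  by rewrite mulrBl mulrBr mulr1 mul1r yC// mulrA.
by rewrite yE subrK scale1r.
Qed.

(** The modulus |c| = sqrt (1 - (1 - c^2)), presented through a square root e of
    it, so that its positivity can be read off in every representation. *)
Lemma abs_exists c : star c = c -> cnorm c <= 1 -> exists e, [/\ star e = e,
  (e * e) * (e * e) = c * c & forall w, w * c = c * w -> w * e = e * w].
Proof.
move=> cs c1; have zs : star (1 - c * c) = 1 - c * c by rewrite starB star1 starM cs.
have [y [ys y1 yE yC]] := sqrt_one_sub (cnorm_one_sub_sqr cs c1) zs.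
have [x [xs _ xE xC]] := sqrt_one_sub y1 ys.
exists (1 - x); split; first by rewrite starB star1 xs.
  by rewrite xE yE subKr.
move=> w wc; rewrite mulrBr mulrBl mulr1 mul1r xC// yC//.
by rewrite mulrBr mulrBl mulr1 mul1r mulrA wc -!mulrA wc.
Qed.

End SelfAdjoint.

(** * Faithful representations reflect positivity *)

(** Polarization: over the complex numbers the quadratic form of a linear map
    determines the map. *)
Lemma form_eq0 (R : realType) (H : hilbertType R) (T : H -> H) : linear T ->
  (forall x, hdot (T x) x = 0) -> forall x, T x = 0.
Proof.
move=> Tl T0 x; suff h y : hdot (T x) y = 0.
  by have := h (T x); rewrite hdotE => /eqP; rewrite sqrf_eq0 normr_eq0 => /eqP.
have := T0 (1 *: x + y); have := T0 ('i *: x + y).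
rewrite !Tl !scale1r !(hdotDl, hdotDr, hdotZl, hdotZr) !T0 conjCi.
rewrite !mulr0 !add0r !addr0 => h1 h2.
have ii : 'i * 'i = -1 :> R[i] by rewrite -expr2 sqrCi.
have : 'i * (hdot (T x) y + hdot (T y) x) + ('i * hdot (T x) y + - 'i * hdot (T y) x) = 0.
  by rewrite h1 h2 mulr0 addr0.
have -> : 'i * (hdot (T x) y + hdot (T y) x) +
    ('i * hdot (T x) y + - 'i * hdot (T y) x) = 2 * ('i * hdot (T x) y) by ring.
by move=> /eqP; rewrite !mulf_eq0 pnatr_eq0/= (negPf (neq0Ci _))/= => /eqP.
Qed.

Section Faithful.
Variables (R : realType) (A : cstarAlgType R) (H : hilbertType R).
Variable pi : starRep A H.
Hypothesis pi_inj : faithful pi.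

Lemma faithful_eq0 a : (forall x, pi a x = 0) -> a = 0.
Proof.
move=> a0; apply: pi_inj; apply/funext => x; rewrite a0.
by have := repB pi 0 0 x; rewrite !subrr.
Qed.

Lemma rep_form_star a x : hdot (pi (star a) x) x = (hdot (pi a x) x)^*%R.
Proof. by rewrite rep_star starK -hdotC. Qed.

Lemma rep_form_sqr e x : hdot (pi (star e * e) x) x = `|pi e x| ^+ 2.
Proof. by rewrite repM rep_star starK hdotE. Qed.

Lemma pos_form_star a : (forall x, 0 <= hdot (pi a x) x) -> star a = a.
Proof.
move=> a0; apply/eqP; rewrite -subr_eq0; apply/eqP/faithful_eq0.
apply: form_eq0; first exact: rep_linear.
by move=> x; rewrite repB hdotBl rep_form_star geC0_conj ?subrr.
Qed.

(** With h = |c| = e^2 and q = h - c, commutation gives q (h + c) = 0, hence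
    q h q = - q c q. Under pi the left side is (e q)* (e q) >= 0 and the right
    side is <= 0, so e q = 0, then q^3 = q h q - q c q = 0 and q = 0. *)
Lemma pos_form_sqrt_unit c : cnorm c <= 1 -> (forall x, 0 <= hdot (pi c x) x) ->
  exists e, [/\ star e = e, e * e = c & forall w, w * c = c * w -> w * e = e * w].
Proof.
move=> c1 c0; have cs := pos_form_star c0.
have [e [es eE eC]] := abs_exists cs c1.
exists e; split=> //.
set h := e * e in eE *; pose Q := h - c.
have hc : h * c = c * h by rewrite /h -mulrA -(eC c erefl) mulrA -(eC c erefl) mulrA.
have Qs : star Q = Q by rewrite starB starM es cs.
have QPQ : Q * h * Q = - (Q * c * Q).
  apply/eqP; rewrite -addr_eq0 -mulrDl -mulrDr [Q * (h + c)]mulrDr !mulrBl eE hc.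
  by rewrite addrA subrK subrr mul0r.
have QhQ : Q * h * Q = star (e * Q) * (e * Q) by rewrite starM Qs es !mulrA.
have eQ : e * Q = 0.
  apply: faithful_eq0 => x; apply/eqP.
  rewrite -normr_eq0 -sqrf_eq0 eq_le exprn_ge0// andbT -rep_form_sqr -QhQ QPQ.
  rewrite -[- _]sub0r repB hdotBl -[X in X - _](_ : 0 = _); last first.
    by have := repB pi 0 0 x; rewrite !subrr => ->; rewrite -(scale0r (0 : H)) hdotZl mul0r.
  by rewrite subr_le0 -mulrA repM rep_star Qs repM c0.
apply/eqP; rewrite -subr_eq0 -/Q; apply/eqP/cube_eq0 => //.
have -> : Q * Q * Q = Q * h * Q - Q * c * Q by rewrite -mulrBl -mulrBr.
by rewrite -QPQ QhQ eQ mulr0 addr0.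
Qed.

(** The previous lemma applied to c divided by its norm. *)
Lemma pos_form_sqrt c : (forall x, 0 <= hdot (pi c x) x) ->
  exists e, [/\ star e = e, e * e = c & forall w, w * c = c * w -> w * e = e * w].
Proof.
move=> c0; have [->|cn0] := eqVneq c 0.
  by exists 0; split=> [||w _]; rewrite ?star0 ?mulr0 ?mul0r.
have t0 : 0 < cnorm c.
  by rewrite lt_neqAle cnorm_ge0 andbT eq_sym; apply: contra cn0 => /eqP/cnorm_eq0->.
have ti0 : 0 <= (cnorm c)^-1 by rewrite invr_ge0 ltW.
have [||e [es eE eC]] := @pos_form_sqrt_unit ((cnorm c)^-1%:C *: c).
- by rewrite cnormZr// mulVf// gt_eqF.
- by move=> x; rewrite repZ hdotZl mulr_ge0// ler0c.
pose t := Num.sqrt (cnorm c).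
exists (t%:C *: e); split.
- by rewrite starZr es.
- rewrite -scalerAl -scalerAr eE !scalerA -!rmorphM/= -expr2 sqr_sqrtr ?ltW//.
  by rewrite mulfV ?scale1r// gt_eqF.
move=> w wc; rewrite -scalerAr -scalerAl eC//.
by rewrite -scalerAr -scalerAl wc.
Qed.

(** If pi(a) is bounded by M, then b = a* a and M^2 - b have nonnegative forms,
    hence commuting self-adjoint square roots g and f with g^2 + f^2 = M^2, which
    bounds the norm of g. *)
Lemma faithful_isometric a (M : R) : 0 <= M ->
  (forall x, `|pi a x| <= M%:C * `|x|) -> cnorm a <= M.
Proof.
move=> M0 aM; pose b := star a * a.
have [x|g [gs gE gC]] := @pos_form_sqrt b.
  by rewrite rep_form_sqr exprn_ge0.
have [x|f [fs fE fC]] := @pos_form_sqrt ((M ^+ 2)%:C *: 1 - b).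
  rewrite repB repZ rep1 hdotBl hdotZl hdotE rep_form_sqr subr_ge0.
  by rewrite rmorphXn/= -exprMn ler_sqr ?nnegrE// mulr_ge0// ler0c.
rewrite -ler_sqr ?nnegrE ?cnorm_ge0// -cnorm_star -/b -gE cnorm_sqr//.
apply: (@cnorm_le_sum_sqr _ _ _ f) => //; last by rewrite fE gE addrC subrK.
  apply/esym/gC/esym/fC.
  by rewrite mulrBr mulrBl -scalerAr -scalerAl mulr1 mul1r.
by rewrite exprn_ge0.
Qed.

End Faithful.

(** * Hilbert spaces, operator norms and square-summable families *)
Section HilbertExtra.
Variables (R : realType) (H : hilbertType R).
Implicit Types x y : H.

(** The case of the Cauchy-Schwarz inequality that the C*-identity of the
    operator norm uses; it comes from expanding the triangle inequality. *)
Lemma hdot_le x y : 0 <= hdot x y -> hdot x y <= `|x| * `|y|.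
Proof.
move=> xy0; have yx : hdot y x = hdot x y by rewrite hdotC geC0_conj.
have : `|x + y| ^+ 2 <= (`|x| + `|y|) ^+ 2.
  by rewrite ler_sqr ?nnegrE ?addr_ge0// ler_normD.
rewrite -hdotE !hdotDl !hdotDr !hdotE yx -subr_ge0.
move: (hdot x y) `|x| `|y| => c a b.
have -> : (a + b) ^+ 2 - (a ^+ 2 + c + (c + b ^+ 2)) = 2 * (a * b - c) by ring.
by rewrite pmulr_rge0 ?ltr0n// subr_ge0.
Qed.

Lemma hdot_sum_l (I : Type) (r : seq I) (P : pred I) (F : I -> H) y :
  hdot (\sum_(i <- r | P i) F i) y = \sum_(i <- r | P i) hdot (F i) y.
Proof.
apply: (big_morph (fun x => hdot x y)) => [x x'|]; first exact: hdotDl.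
by rewrite -(scale0r (0 : H)) hdotZl mul0r.
Qed.

Lemma hdot_sum_r (I : Type) (r : seq I) (P : pred I) (F : I -> H) x :
  hdot x (\sum_(i <- r | P i) F i) = \sum_(i <- r | P i) hdot x (F i).
Proof.
apply: (big_morph (fun y => hdot x y)) => [y y'|]; first exact: hdotDr.
by rewrite -(scale0r (0 : H)) hdotZr conjC0 mul0r.
Qed.

Lemma bounded_linear_map_continuous (T : H -> H) (M : R) : linear T -> 0 <= M ->
  (forall x, `|T x| <= M%:C * `|x|) -> continuous T.
Proof.
move=> Tl M0 TM x; apply/cvgrPdist_le => e e0.
have M1 : 0 < M%:C + 1 by rewrite ltr_wpDl ?ler0c.
near=> y.
have -> : T x - T y = T (x - y).
  by have := Tl (-1) y x; rewrite !scaleN1r [- y + _]addrC [- T y + _]addrC => ->.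
apply: (le_trans (TM _)); apply: (@le_trans _ _ ((M%:C + 1) * `|x - y|)).
  by rewrite ler_wpM2r// lerDl.
rewrite -ler_pdivlMl//; near: y.
by apply: cvgr_dist_le; [exact: cvg_id | rewrite mulr_gt0// invr_gt0].
Unshelve. all: by end_near. Qed.

End HilbertExtra.

Section OperatorNorm.
Variables (R : realType) (K : hilbertType R).
Implicit Types (T : K -> K) (M : R).

Definition op_bound T M : Prop := 0 <= M /\ forall x, `|T x| <= M%:C * `|x|.

Definition op_norm T : R := inf [set M | op_bound T M].

Lemma op_norm_le T M : op_bound T M -> op_norm T <= M.
Proof. by move=> TM; apply: ge_inf => //; exists 0 => N []. Qed.

(** The infimum defining the operator norm is attained as soon as T has some
    bound. *)
Lemma op_normP T M : op_bound T M -> op_bound T (op_norm T).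
Proof.
move=> TM; have ne : [set M | op_bound T M] !=set0 by exists M.
split=> [|x]; first by apply: lb_le_inf => // N [].
have [r r0 rE] := ge0_complexE (normr_ge0 x).
have [s s0 sE] := ge0_complexE (normr_ge0 (T x)).
have key N : op_bound T N -> s <= N * r.
  by move=> [_ /(_ x)]; rewrite rE sE -rmorphM lecR.
rewrite rE sE -rmorphM lecR.
have [r00|rn0] := eqVneq r 0.
  by move: (key _ TM); rewrite r00 !mulr0.
have rp : 0 < r by rewrite lt_neqAle eq_sym rn0.
rewrite -ler_pdivrMr//; apply: lb_le_inf => // N /key.
by rewrite ler_pdivrMr.
Qed.

End OperatorNorm.

Section SumFinite.
Variables (R : realType) (G : choiceType).

Lemma sum_finite_support (f : G -> R[i]^o) (A : {fset G}) :
  (forall g, g \notin A -> f g = 0) -> sum f = \sum_(g <- A) f g.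
Proof.
move=> fA; apply: cvg_sum; apply/cvgrPdist_le => e e0; exists A => // B /= AB.
rewrite partial_sumE (big_fset_incl _ AB) ?subrr ?normr0 ?ltW// => g _.
exact: fA.
Qed.

Variable H : hilbertType R.

Lemma ell2_ext (x y : ell2 G H) : (forall g, x g = y g) -> x = y.
Proof. by move=> xy; apply/val_inj/funext. Qed.

Lemma ell2DE (x y : ell2 G H) g : (x + y) g = x g + y g. Proof. by []. Qed.

Lemma ell2ZE (k : R[i]) (x : ell2 G H) g : (k *: x) g = k *: x g.
Proof. by []. Qed.

Lemma ell2_sumE (I : Type) (r : seq I) (P : pred I) (F : I -> ell2 G H) g :
  (\sum_(i <- r | P i) F i) g = \sum_(i <- r | P i) F i g.
Proof. by apply: (big_morph (fun x : ell2 G H => x g)). Qed.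

Lemma single_subproof (h : G) (v : H) :
  (fun g => if g == h then v else 0) \in @sqsummable R G H.
Proof.
apply/asboolP; exists (`|v| ^+ 2) => A.
have nn g : 0 <= `|if g == h then v else 0| ^+ 2 by rewrite exprn_ge0.
apply: (@le_trans _ _ (\sum_(g <- (h |` A)%fset) `|if g == h then v else 0| ^+ 2)).
  exact: sum_fsubset nn (fsubsetUr _ _).
rewrite -(@big_fset_incl _ _ _ _ [fset h]%fset).
- by rewrite big_seq_fset1 eqxx.
- exact: fsubsetUl.
by move=> g _; rewrite in_fset1 => /negPf ->; rewrite normr0 expr0n.
Qed.

Definition single (h : G) (v : H) : ell2 G H := Ell2 (single_subproof h v).

Lemma hdot_single (xi : ell2 G H) h v : hdot xi (single h v) = hdot (xi h) v.
Proof.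
have E : forall y z : ell2 G H, hdot y z = ell2_dot y z by [].
rewrite E /ell2_dot (@sum_finite_support _ [fset h]%fset).
  by rewrite big_seq_fset1 /= eqxx.
by move=> g; rewrite in_fset1 /= => /negPf ->; rewrite -(scale0r (0 : H)) hdotZr conjC0 mul0r.
Qed.

Lemma norm_single h v : `|single h v| = `|v|.
Proof.
apply/eqP; rewrite -(@eqrXn2 _ 2)//; apply/eqP.
by rewrite -!hdotE hdot_single /= eqxx.
Qed.

End SumFinite.

Section FiniteEll2.
Variables (R : realType) (I : finType) (H : hilbertType R).

Lemma big_fset_finType (V : nmodType) (F : I -> V) :
  \sum_(g <- [fset x in I]%fset) F g = \sum_i F i.
Proof.
apply: perm_big; apply: uniq_perm; rewrite ?fset_uniq ?index_enum_uniq// => x.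
by rewrite mem_index_enum !inE.
Qed.

Lemma vec_subproof (v : I -> H) : v \in @sqsummable R I H.
Proof.
apply/asboolP; exists (\sum_(g <- [fset x in I]%fset) `|v g| ^+ 2) => A.
apply: (@sum_fsubset R I (fun g => `|v g| ^+ 2)) => [g|]; first exact: exprn_ge0.
by apply/fsubsetP => x _; rewrite !inE.
Qed.

Definition vec (v : I -> H) : ell2 I H := Ell2 (vec_subproof v).

Lemma hdot_finE (x y : ell2 I H) : hdot x y = \sum_i hdot (x i) (y i).
Proof.
have -> : hdot x y = ell2_dot x y by [].
rewrite /ell2_dot (@sum_finite_support _ _ _ [fset x in I]%fset).
  exact: big_fset_finType.
by move=> g; rewrite !inE.
Qed.

Lemma sum_single (x : ell2 I H) : x = \sum_i single i (x i).
Proof.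
apply: ell2_ext => g; rewrite ell2_sumE (bigD1 g)//= eqxx big1 ?addr0// => i.
by rewrite eq_sym => /negPf ->.
Qed.

Lemma ell2_norm_le_sum (x : ell2 I H) : `|x| <= \sum_i `|x i|.
Proof.
rewrite {1}(sum_single x); apply: (le_trans (ler_norm_sum _ _ _)).
by apply: ler_sum => i _; rewrite norm_single.
Qed.

End FiniteEll2.

(** * Matrices over a C*-algebra as a C*-algebra *)
Section MatrixAction.
Variables (R : realType) (C : cstarAlgType R) (H : hilbertType R).
Variable pi : starRep C H.
Variable n : nat.
Implicit Types (X Y : 'M[C]_n) (xi eta : ell2 'I_n H).

Definition mx_act X xi : ell2 'I_n H := vec (fun i => \sum_j pi (X i j) (xi j)).

Lemma mx_act_linear X : linear (mx_act X).
Proof.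
move=> k x y; apply: ell2_ext => i.
rewrite ell2DE ell2ZE /= scaler_sumr -big_split; apply: eq_bigr => j _ /=.
exact: rep_linear.
Qed.

Definition mx_bound X : R := \sum_i \sum_j cnorm (X i j).

Lemma mx_act_bound X : op_bound (mx_act X) (mx_bound X).
Proof.
split; first by do 2![apply: sumr_ge0 => ? _]; exact: cnorm_ge0.
move=> xi; apply: (le_trans (ell2_norm_le_sum _)).
rewrite rmorph_sum mulr_suml; apply: ler_sum => i _ /=.
apply: (le_trans (ler_norm_sum _ _ _)).
rewrite rmorph_sum mulr_suml; apply: ler_sum => j _ /=.
apply: (le_trans (rep_contr _ _ _)); rewrite ler_wpM2l ?ler0c ?cnorm_ge0//.
exact: ell2_coord_le.
Qed.

Lemma mx_act_continuous X : continuous (mx_act X).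
Proof.
have [b0 b] := mx_act_bound X.
by apply: bounded_linear_map_continuous b; first exact: mx_act_linear.
Qed.

Lemma mx_actD X Y xi : mx_act (X + Y) xi = mx_act X xi + mx_act Y xi.
Proof.
apply: ell2_ext => i; rewrite ell2DE /= -big_split; apply: eq_bigr => j _ /=.
by rewrite mxE repD.
Qed.

Lemma mx_actZ (k : R[i]) X xi : mx_act (map_mx (fun a => k *: a) X) xi = k *: mx_act X xi.
Proof.
apply: ell2_ext => i; rewrite ell2ZE /= scaler_sumr; apply: eq_bigr => j _ /=.
by rewrite mxE repZ.
Qed.

Lemma rep_0l x : pi 0 x = 0.
Proof. by rewrite -(scale0r (0 : C)) repZ scale0r. Qed.

Lemma rep_0r a : pi a 0 = 0.
Proof. by have := rep_linear pi a (-1) 0 0; rewrite !scaleN1r !addNr. Qed.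

Lemma rep_suml (I : Type) (r : seq I) (P : pred I) (F : I -> C) x :
  pi (\sum_(i <- r | P i) F i) x = \sum_(i <- r | P i) pi (F i) x.
Proof.
apply: (big_morph (fun a => pi a x)); last exact: rep_0l.
by move=> a b; exact: repD.
Qed.

Lemma rep_sumr (I : Type) (r : seq I) (P : pred I) (F : I -> H) a :
  pi a (\sum_(i <- r | P i) F i) = \sum_(i <- r | P i) pi a (F i).
Proof.
apply: (big_morph (pi a)) => [x y|]; last exact: rep_0r.
by have := rep_linear pi a 1 x y; rewrite !scale1r.
Qed.

Lemma mx_actM X Y xi : mx_act (X *m Y) xi = mx_act X (mx_act Y xi).
Proof.
apply: ell2_ext => i /=.
under eq_bigr do rewrite mxE rep_suml.
rewrite exchange_big; apply: eq_bigr => j _ /=.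
by rewrite rep_sumr; apply: eq_bigr => k _; rewrite repM.
Qed.

Lemma mx_act1 xi : mx_act 1%:M xi = xi.
Proof.
apply: ell2_ext => i; rewrite /= (bigD1 i)//= mxE eqxx rep1 big1 ?addr0// => j.
by rewrite eq_sym mxE => /negPf ->; rewrite mulr0n rep_0l.
Qed.

Lemma mx_act_form X xi eta :
  hdot (mx_act X xi) eta = \sum_i \sum_j hdot (pi (X i j) (xi j)) (eta i).
Proof. by rewrite hdot_finE; apply: eq_bigr => i _; rewrite hdot_sum_l. Qed.

Lemma mx_act_star X xi eta :
  hdot (mx_act X xi) eta = hdot xi (mx_act (adjmx star X) eta).
Proof.
rewrite mx_act_form exchange_big hdot_finE; apply: eq_bigr => j _ /=.
rewrite hdot_sum_r; apply: eq_bigr => i _.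
by rewrite !mxE rep_star.
Qed.

Lemma mx_act_entry X i j (v : H) : mx_act X (single j v) i = pi (X i j) v.
Proof.
by rewrite /= (bigD1 j)//= eqxx big1 ?addr0// => k /negPf ->; rewrite rep_0r.
Qed.

(** The only place where completeness of the matrix algebra depends on pi being
    isometric: convergence in operator norm forces convergence of the entries. *)
Lemma cnorm_entry_le X i j : faithful pi -> cnorm (X i j) <= op_norm (mx_act X).
Proof.
move=> pi_inj; have [b0 b] := op_normP (mx_act_bound X).
apply: (faithful_isometric pi_inj b0) => v.
rewrite -mx_act_entry; apply: (le_trans (ell2_coord_le _ _)).
by apply: (le_trans (b _)); rewrite norm_single.
Qed.

End MatrixAction.

(** A copy of the square matrices over C. The representation and its
    faithfulness are parameters of the type because the norm is the operator norm
    under it; the size is a successor because algebras are nonzero. *)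
Definition mxalg (R : realType) (C : cstarAlgType R) (H : hilbertType R)
  (pi : starRep C H) (pi_inj : faithful pi) (n : nat) := 'M[C]_n.+1.

Section MatrixAlgebra.
Variables (R : realType) (C : cstarAlgType R) (H : hilbertType R).
Variables (pi : starRep C H) (pi_inj : faithful pi) (n : nat).
Local Notation M := (mxalg pi_inj n).
Implicit Types (X Y : M).

HB.instance Definition _ := GRing.NzRing.on M.

Definition mxscale (k : R[i]) X : M := map_mx (fun a => k *: a) X.

Lemma mxscaleA a b X : mxscale a (mxscale b X) = mxscale (a * b) X.
Proof. by apply/matrixP => i j; rewrite !mxE scalerA. Qed.
Lemma mxscale1 : left_id 1 mxscale.
Proof. by move=> X; apply/matrixP => i j; rewrite !mxE scale1r. Qed.
Lemma mxscaleDr : right_distributive mxscale +%R.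
Proof. by move=> k X Y; apply/matrixP => i j; rewrite !mxE scalerDr. Qed.
Lemma mxscaleDl X : {morph mxscale^~ X : a b / a + b}.
Proof. by move=> a b; apply/matrixP => i j; rewrite !mxE scalerDl. Qed.

HB.instance Definition _ := GRing.Zmodule_isLmodule.Build R[i] M
  mxscaleA mxscale1 mxscaleDr mxscaleDl.

Lemma mxscaleAl (k : R[i]) X Y : k *: (X * Y) = k *: X * Y.
Proof.
apply/matrixP => i j; rewrite !mxE scaler_sumr; apply: eq_bigr => l _.
by rewrite mxE scalerAl.
Qed.

HB.instance Definition _ := GRing.Lmodule_isLalgebra.Build R[i] M mxscaleAl.

Lemma mxscaleAr (k : R[i]) X Y : k *: (X * Y) = X * (k *: Y).
Proof.
apply/matrixP => i j; rewrite !mxE scaler_sumr; apply: eq_bigr => l _.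
by rewrite mxE scalerAr.
Qed.

HB.instance Definition _ := GRing.Lalgebra_isAlgebra.Build R[i] M mxscaleAr.

Definition mxstar X : M := adjmx star X.

Definition mxnorm X : R := op_norm (mx_act pi X).

Lemma mxnormP X : op_bound (mx_act pi X) (mxnorm X).
Proof. exact: op_normP (mx_act_bound pi X). Qed.

Lemma mxstarD X Y : mxstar (X + Y) = mxstar X + mxstar Y.
Proof. by apply/matrixP => i j; rewrite !mxE starD. Qed.

Lemma mxstarZ (k : R[i]) X : mxstar (k *: X) = k^*%R *: mxstar X.
Proof. by apply/matrixP => i j; rewrite !mxE starZ. Qed.

Lemma mxstarM X Y : mxstar (X * Y) = mxstar Y * mxstar X.
Proof.
apply/matrixP => i j; rewrite !mxE.
rewrite (big_morph (@star R C) (@starD R C) (star0 C)); apply: eq_bigr => l _.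
by rewrite !mxE starM.
Qed.

Lemma mxstarK : involutive mxstar.
Proof. by move=> X; apply/matrixP => i j; rewrite !mxE starK. Qed.

Lemma mxnorm_eq0 X : mxnorm X = 0 -> X = 0.
Proof.
move=> X0; apply/matrixP => i j; rewrite mxE; apply: cnorm_eq0; apply/eqP.
by rewrite eq_le cnorm_ge0 andbT -X0 cnorm_entry_le.
Qed.

Lemma mxnormD X Y : mxnorm (X + Y) <= mxnorm X + mxnorm Y.
Proof.
have [x0 xb] := mxnormP X; have [y0 yb] := mxnormP Y.
apply: op_norm_le; split=> [|xi]; first exact: addr_ge0.
rewrite mx_actD rmorphD mulrDl; apply: (le_trans (ler_normD _ _)).
exact: lerD.
Qed.

Lemma normr_complexE (k : R[i]) : `|k| = (complex.Re `|k|)%:C.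
Proof. by have [r _ ->] := ge0_complexE (normr_ge0 k). Qed.

Lemma Re_norm_ge0 (k : R[i]) : 0 <= complex.Re `|k|.
Proof. by rewrite -ler0c -normr_complexE. Qed.

Lemma mxnormZ_le (k : R[i]) X : mxnorm (k *: X) <= complex.Re `|k| * mxnorm X.
Proof.
have [x0 xb] := mxnormP X.
apply: op_norm_le; split=> [|xi]; first by rewrite mulr_ge0// Re_norm_ge0.
by rewrite mx_actZ normrZ rmorphM/= -normr_complexE -mulrA ler_wpM2l.
Qed.

Lemma mxnormZ (k : R[i]) X : mxnorm (k *: X) = complex.Re `|k| * mxnorm X.
Proof.
apply/eqP; rewrite eq_le mxnormZ_le andTb.
have [->|k0] := eqVneq k 0.
  by rewrite normr0 mul0r; have [] := mxnormP (0 *: X).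
have kp : 0 < complex.Re `|k| by rewrite -ltcR -normr_complexE normr_gt0.
rewrite -ler_pdivlMl//; have := mxnormZ_le k^-1 (k *: X).
rewrite scalerA mulVf// scale1r normfV [in X in X -> _]normr_complexE.
by rewrite -fmorphV.
Qed.

Lemma mxnormM X Y : mxnorm (X * Y) <= mxnorm X * mxnorm Y.
Proof.
have [x0 xb] := mxnormP X; have [y0 yb] := mxnormP Y.
apply: op_norm_le; split=> [|xi]; first exact: mulr_ge0.
rewrite mx_actM; apply: (le_trans (xb _)).
by rewrite rmorphM -mulrA ler_wpM2l ?ler0c.
Qed.

(** |X xi|^2 = <X* X xi, xi> <= |X* X| |xi|^2. *)
Lemma mxnorm_sqr_le X : mxnorm X ^+ 2 <= mxnorm (mxstar X * X).
Proof.
have [x0 xb] := mxnormP X; have [y0 yb] := mxnormP (mxstar X * X).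
rewrite -[leRHS]sqr_sqrtr// ler_sqr ?nnegrE ?sqrtr_ge0//.
apply: op_norm_le; split=> [|xi]; first exact: sqrtr_ge0.
rewrite -ler_sqr ?nnegrE ?mulr_ge0 ?ler0c ?sqrtr_ge0//.
rewrite exprMn -rmorphXn/= sqr_sqrtr//.
have E : `|mx_act pi X xi| ^+ 2 = hdot (mx_act pi (mxstar X * X) xi) xi.
  have -> : mx_act pi (mxstar X * X) xi = mx_act pi (mxstar X) (mx_act pi X xi) by exact: mx_actM.
  by rewrite mx_act_star -[adjmx _ _]/(mxstar (mxstar X)) mxstarK hdotE.
rewrite E; apply: le_trans (hdot_le _) _; first by rewrite -E exprn_ge0.
by rewrite expr2 mulrA ler_wpM2r.
Qed.

Lemma mxnorm_le_star X : mxnorm X <= mxnorm (mxstar X).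
Proof.
have [x0|x0] := eqVneq (mxnorm X) 0; first by rewrite x0; have [] := mxnormP (mxstar X).
have xp : 0 < mxnorm X by rewrite lt_neqAle eq_sym x0; have [] := mxnormP X.
by rewrite -(ler_pM2r xp) -expr2 (le_trans (mxnorm_sqr_le X))// mxnormM.
Qed.

Lemma mxnorm_star X : mxnorm (mxstar X * X) = mxnorm X ^+ 2.
Proof.
apply/eqP; rewrite eq_le mxnorm_sqr_le andbT (le_trans (mxnormM _ _))//.
rewrite expr2 ler_wpM2r//; first by have [] := mxnormP X.
by rewrite -[X in _ <= mxnorm X]mxstarK mxnorm_le_star.
Qed.

(** The entries converge, and the operator norm is at most the sum of the norms
    of the entries. *)
Lemma mxnorm_complete (u : nat -> M) :
  (forall e : R, 0 < e -> exists N, forall m n,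
     (N <= m)%N -> (N <= n)%N -> mxnorm (u m - u n) < e) ->
  exists l : M, forall e : R, 0 < e -> exists N, forall n,
     (N <= n)%N -> mxnorm (l - u n) < e.
Proof.
move=> cu.
have lim i j : {l | cnorm_lim (fun m => u m i j) l}.
  apply: cid; apply: cnorm_complete => e /cu[N hN]; exists N => p q Np Nq.
  apply: le_lt_trans (hN _ _ Np Nq).
  by have := @cnorm_entry_le _ _ _ pi _ (u p - u q) i j pi_inj; rewrite !mxE.
exists (\matrix_(i, j) sval (lim i j)).
set l := \matrix_(i, j) _.
have b_cvg : (fun m => mx_bound (l - u m)) @ \oo --> (0 : R).
  rewrite [X in _ --> X](_ : 0 = \sum_(i < n.+1) \sum_(j < n.+1) 0 :> R); last first.
    by rewrite big1// => i _; rewrite big1.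
  apply: cvg_big => [|i _]; first exact: add_continuous.
  apply: cvg_big => [|j _]; first exact: add_continuous.
  under eq_fun do rewrite !mxE.
  exact: cnorm_lim_cvg (svalP (lim i j)).
move=> e e0; have /cvgr0Pnorm_lt/(_ _ e0)[N _ hN] := b_cvg.
exists N => m Nm; apply: le_lt_trans (op_norm_le (mx_act_bound pi (l - u m))) _.
by apply: le_lt_trans (hN m Nm); rewrite ler_norm.
Qed.

HB.instance Definition _ := isCStarAlgebra.Build R M
  mxstarD mxstarZ mxstarM mxstarK mxnorm_eq0 mxnormD mxnormZ mxnormM
  mxnorm_star mxnorm_complete.

Definition mxrep : starRep M (ell2 'I_n.+1 H) :=
  @StarRep R M (ell2 'I_n.+1 H) (@mx_act _ _ _ pi n.+1)
    (@mx_act_linear _ _ _ pi n.+1) (@mx_act_continuous _ _ _ pi n.+1)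
    (@mx_actD _ _ _ pi n.+1) (@mx_actZ _ _ _ pi n.+1) (@mx_actM _ _ _ pi n.+1)
    (@mx_act1 _ _ _ pi n.+1) (@mx_act_star _ _ _ pi n.+1).

Lemma mxrep_faithful : faithful mxrep.
Proof.
move=> X Y XY; apply/matrixP => i j; apply: pi_inj; apply/funext => v.
rewrite -!mx_act_entry.
by rewrite -[mx_act pi X]/(mxrep X) XY.
Qed.

End MatrixAlgebra.

(** The n = 1 result [pos_form_sqrt] read in the C*-algebra of n x n matrices
    acting on H^n. *)
Lemma cstar_cone_op_cone (R : realType) (C : cstarAlgType R) (H : hilbertType R)
    (pi : starRep C H) (pi_inj : faithful pi) n (X : 'M[C]_n) :
  cstar_cone X <-> op_cone (map_mx pi X).
Proof.
case: n X => [|n] X.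
  split=> [_ xi|_]; first by rewrite big_ord0.
  by exists 0; apply/matrixP => -[].
pose rep := mxrep pi_inj n; pose XM : mxalg pi_inj n := X.
have form (xi : 'I_n.+1 -> H) : hdot (rep XM (vec xi)) (vec xi) =
    \sum_i \sum_j hdot (map_mx pi X i j (xi j)) (xi i).
  rewrite [LHS]mx_act_form; apply: eq_bigr => i _; apply: eq_bigr => j _.
  by rewrite mxE.
split=> [[Y XE] xi|Xpos].
  rewrite -form (_ : XM = star (Y : mxalg pi_inj n) * Y)//.
  by rewrite rep_form_sqr exprn_ge0.
have [|e [es eE _]] := @pos_form_sqrt _ _ _ rep (@mxrep_faithful _ _ _ _ pi_inj n) XM.
  move=> xi; rewrite (_ : xi = vec xi); last exact: ell2_ext.
  by rewrite form; exact: Xpos.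
by exists e; rewrite -[LHS]eE -{1}es.
Qed.

(** * Density of finitely supported vectors *)
Section Limits.
Variables (R : realType) (H : hilbertType R).
Variables (T : Type) (F : set_system T) (FF : ProperFilter F).

(** By polarization the inner product is a combination of norms, so its joint
    continuity is that of the norm. *)
Lemma cvg_hdot (x y : T -> H) (a b : H) : x @ F --> a -> y @ F --> b ->
  (fun t => hdot (x t) (y t) : R[i]^o) @ F --> (hdot a b : R[i]^o).
Proof.
move=> xa yb; rewrite polarization.
under eq_fun do rewrite polarization.
have sq (u : T -> H) c : u @ F --> c ->
    (fun t => `|u t| ^+ 2 : R[i]^o) @ F --> (`|c| ^+ 2 : R[i]^o).
  by move=> /cvg_norm uc; rewrite expr2; exact: (cvgM uc uc).
have iy : (fun t => 'i *: y t) @ F --> 'i *: b by exact: cvgZl_tmp.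
have sqD (u v : T -> H) (c d : H) : u @ F --> c -> v @ F --> d ->
    (fun t => `|u t + v t| ^+ 2 : R[i]^o) @ F --> (`|c + d| ^+ 2 : R[i]^o).
  by move=> uc vd; apply: (sq (fun t => u t + v t)); exact: cvgD.
have sqB (u v : T -> H) (c d : H) : u @ F --> c -> v @ F --> d ->
    (fun t => `|u t - v t| ^+ 2 : R[i]^o) @ F --> (`|c - d| ^+ 2 : R[i]^o).
  by move=> uc vd; apply: (sq (fun t => u t - v t)); exact: cvgB.
apply: (@cvgMl_tmp R[i]).
apply: cvgB; last exact: (cvgMl_tmp (sqB _ _ _ _ xa iy)).
apply: cvgD; last exact: (cvgMl_tmp (sqD _ _ _ _ xa iy)).
exact: (cvgB (sqD _ _ _ _ xa yb) (sqB _ _ _ _ xa yb)).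
Qed.

Lemma cvg_ge0 (z : T -> R[i]^o) (l : R[i]^o) : z @ F --> l ->
  (forall t, 0 <= (z t : R[i])) -> 0 <= (l : R[i]).
Proof.
move=> zl z0; suff -> : (l : R[i]) = `|l| by exact: normr_ge0.
have zn : z @ F --> (`|l| : R[i]^o).
  apply/cvgrPdist_le => e e0; have /cvgrPdist_le/(_ _ e0) := zl.
  apply: filterS => t; apply: le_trans; rewrite -{1}(ger0_norm (z0 t)).
  exact: ler_dist_dist.
have haus := @norm_hausdorff R[i] R[i]^o.
by rewrite -[LHS](cvg_lim haus zl) -[RHS](cvg_lim haus zn).
Qed.
End Limits.

Section Truncation.
Variables (R : realType) (G : choiceType) (H : hilbertType R).

Definition trunc (A : {fset G}) (xi : ell2 G H) : ell2 G H :=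
  \sum_(h <- A) single h (xi h).

Lemma truncE A xi g : trunc A xi g = if g \in A then xi g else 0.
Proof.
rewrite ell2_sumE /=; case: ifPn => gA.
  rewrite (big_fsetD1 g)//= eqxx big1_fset ?addr0// => h.
  by rewrite in_fsetD1 eq_sym => /andP[/negPf ->].
rewrite big1_fset// => h hA _; case: eqP => // gh.
by rewrite gh hA in gA.
Qed.

(** Outside A the squares of the norms of xi sum to at most
    <xi, xi> - sum_(g in A) |xi g|^2, which is small for large A. *)
Lemma trunc_cvg xi : (fun A => trunc A xi) @ totally --> xi.
Proof.
apply/cvgrPdist_le => e e0.
have [dot_cvg le_dot _] := ell2_sq xi.
have /cvgrPdist_le/(_ _ (exprn_gt0 2 e0))[A0 _ hA0] := dot_cvg.
exists A0 => // A /= A0A; apply: ell2_norm_le; first exact: ltW.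
move=> B; have {hA0} := hA0 _ A0A; rewrite partial_sumE ger0_norm ?subr_ge0//.
apply: le_trans; rewrite lerBrDr; apply: le_trans (le_dot (A `|` B)%fset).
pose f g := if g \in A then 0 else `|xi g| ^+ 2.
pose f' g := if g \in A then `|xi g| ^+ 2 else 0.
have -> : \sum_(g <- B) `|(xi - trunc A xi) g| ^+ 2 = \sum_(g <- B) f g.
  apply: eq_bigr => g _.
  rewrite (_ : (xi - trunc A xi) g = xi g - trunc A xi g)// truncE /f.
  by case: ifP => _; rewrite ?subrr ?normr0 ?expr0n// subr0.
have -> : \sum_(g <- A) `|xi g| ^+ 2 = \sum_(g <- A) f' g.
  by apply: eq_big_seq => g gA; rewrite /f' gA.
rewrite (@big_fset_incl _ _ _ _ A (A `|` B)%fset f') ?fsubsetUl//; last first.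
  by move=> g _ /negPf gA; rewrite /f' gA.
apply: (@le_trans _ _ (\sum_(g <- (A `|` B)%fset) f g +
    \sum_(g <- (A `|` B)%fset) f' g)).
  rewrite lerD2r; apply: (@sum_fsubset R G f) (fsubsetUr _ _) => g.
  by rewrite /f; case: ifP => // _; rewrite exprn_ge0.
rewrite -big_split/=; apply: ler_sum => g _; rewrite /f /f'.
by case: ifP => _; rewrite ?addr0 ?add0r.
Qed.
End Truncation.

(** * Positivity in the reduced crossed product *)
Section CrossedProduct.
Variables (R : realType) (S : operatorSystemType R) (G : groupType).
Variable X : dynamicalSystem S G.
Variables (C : cstarAlgType R) (rho : S -> C) (alpha : cstarAction G C).
Variables (H : hilbertType R) (pi : starRep C H).
Local Notation L2 := (ell2 G H).
Implicit Types (w : seq (S * G)) (xi : L2).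

(** A word, a finite list of pairs (x, g), is a formal element of the crossed
    product; scalars are absorbed into the first components. *)
Definition word_op w : L2 -> L2 :=
  \sum_(p <- w) (pi_tilde alpha pi (rho p.1) \o lambda (H := H) p.2).

Lemma word_opE w xi h :
  word_op w xi h = \sum_(p <- w) pi (alpha h^-1%g (rho p.1)) (xi (p.2^-1 * h)%g).
Proof. by rewrite /word_op fct_sumE ell2_sumE. Qed.

Lemma word_op_linear w : linear (word_op w).
Proof.
move=> k x y; apply: ell2_ext => h.
rewrite ell2DE ell2ZE !word_opE scaler_sumr -big_split; apply: eq_bigr => p _ /=.
exact: rep_linear.
Qed.

Lemma norm_lambda_le g xi : `|lambda g xi| <= `|xi|.
Proof.
apply: ell2_norm_le => // A.
have [_ le_dot _] := ell2_sq xi.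
have := le_dot [fset (g^-1 * h)%g | h in A]%fset.
rewrite big_imfset/=; last by move=> x y _ _; exact: mulgI.
by move/le_trans; apply; rewrite -ell2_norm_sq.
Qed.

Lemma norm_pi_tilde_le a xi : `|pi_tilde alpha pi a xi| <= (cnorm a)%:C * `|xi|.
Proof.
have a0 : 0 <= (cnorm a)%:C by rewrite ler0c cnorm_ge0.
apply: ell2_norm_le => [|A]; first exact: mulr_ge0.
apply: (@le_trans _ _ (\sum_(h <- A) (cnorm a)%:C ^+ 2 * `|xi h| ^+ 2)).
  apply: ler_sum => h _; rewrite -exprMn ler_sqr ?nnegrE ?mulr_ge0//.
  exact: (rep_contr (rep_act alpha pi h^-1%g)).
rewrite -mulr_sumr exprMn ler_wpM2l ?exprn_ge0//.
by have [_ + _] := ell2_sq xi; rewrite -ell2_norm_sq; apply.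
Qed.

Lemma word_op_continuous w : continuous (word_op w).
Proof.
apply: (@bounded_linear_map_continuous _ _ _ (\sum_(p <- w) cnorm (rho p.1))).
- exact: word_op_linear.
- by apply: sumr_ge0 => p _; exact: cnorm_ge0.
move=> xi; rewrite /word_op fct_sumE rmorph_sum mulr_suml.
apply: (le_trans (ler_norm_sum _ _ _)); apply: ler_sum => p _ /=.
apply: (le_trans (norm_pi_tilde_le _ _)).
by rewrite ler_wpM2l ?ler0c ?cnorm_ge0// norm_lambda_le.
Qed.

(** The element of S whose image under pi o rho is the (h, k) entry of the
    operator of w on l2(G, H). *)
Definition block w (h k : G) : S :=
  \sum_(p <- w | (p.2^-1 * h)%g == k) X h^-1%g p.1.

(** Points of G and row indices are listed by arbitrary functions h and f, not
    necessarily injective: repetitions amount to a compression of the matrix and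
    allow reading any finite family of vectors in l2(G, H)^n as a test. *)
Definition word_pos n (w : 'I_n -> 'I_n -> seq (S * G)) : Prop :=
  forall N (f : 'I_N -> 'I_n) (h : 'I_N -> G),
    os_cone _ (\matrix_(a, b) block (w (f a) (f b)) (h a) (h b)).

Hypothesis rho_coe :
  complete_order_embedding (@os_cone R S) (@cstar_cone R C) setT rho.
Hypothesis adm : admissible X rho alpha.
Hypothesis pi_inj : faithful pi.

Lemma rho_sum (I : Type) (r : seq I) (P : pred I) (F : I -> S) :
  rho (\sum_(i <- r | P i) F i) = \sum_(i <- r | P i) rho (F i).
Proof.
have lin k x y : rho (k *: x + y) = k *: rho x + rho y by exact: (coe_linear rho_coe).
apply: (big_morph rho) => [x y|]; first by have := lin 1 x y; rewrite !scale1r.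
by have := lin (-1) 0 0; rewrite !scaleN1r !addNr.
Qed.

Lemma word_op_single w h k v :
  word_op w (single k v) h = pi (rho (block w h k)) v.
Proof.
rewrite word_opE rho_sum rep_suml [RHS]big_mkcond; apply: eq_bigr => p _ /=.
by rewrite adm; case: ifP => // _; rewrite rep_0r.
Qed.

Lemma word_op_sum w (I : Type) (r : seq I) (P : pred I) (F : I -> L2) :
  word_op w (\sum_(i <- r | P i) F i) = \sum_(i <- r | P i) word_op w (F i).
Proof.
apply: (big_morph (word_op w)) => [x y|].
  by have := word_op_linear w 1 x y; rewrite !scale1r.
by have := word_op_linear w (-1) 0 0; rewrite !scaleN1r !addNr.
Qed.

(** On the vectors with finite support, the form of a matrix of words is the form
    of a finite block. *)
Lemma word_form n (w : 'I_n -> 'I_n -> seq (S * G)) (I : finType)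
    (f : I -> 'I_n) (h : I -> G) (v : I -> H) :
  let xi i := \sum_(a | f a == i) single (h a) (v a) in
  \sum_i \sum_j hdot (word_op (w i j) (xi j)) (xi i) =
  \sum_a \sum_b hdot (pi (rho (block (w (f a) (f b)) (h a) (h b))) (v b)) (v a).
Proof.
move=> xi; rewrite [RHS](partition_big f xpredT)//; apply: eq_bigr => i _.
have sum_r y : hdot y (xi i) = \sum_(a | f a == i) hdot y (single (h a) (v a)).
  exact: hdot_sum_r.
rewrite (eq_bigr _ (fun j _ => sum_r (word_op (w i j) (xi j)))) {sum_r}.
rewrite exchange_big; apply: eq_bigr => a /eqP fa.
rewrite [RHS](partition_big f xpredT)//; apply: eq_bigr => j _.
rewrite word_op_sum hdot_sum_l; apply: eq_bigr => b /eqP fb.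
by rewrite hdot_single word_op_single fa fb.
Qed.

Lemma os_cone_form N (Y : 'M[S]_N) : os_cone _ Y <->
  forall v : 'I_N -> H, 0 <= \sum_a \sum_b hdot (pi (rho (Y a b)) (v b)) (v a).
Proof.
rewrite (coe_cone rho_coe)// (cstar_cone_op_cone pi_inj).
split=> h v; have := h v; congr (_ <= _); apply: eq_bigr => a _;
  by apply: eq_bigr => b _; rewrite !mxE.
Qed.

(** Positivity of a matrix of crossed product elements, expressed in S only.
    Positivity on all vectors follows from finitely supported ones, because the
    operators and the inner product are continuous. *)
Lemma op_cone_word_op n (w : 'I_n -> 'I_n -> seq (S * G)) :
  op_cone (\matrix_(i, j) word_op (w i j)) <-> word_pos w.
Proof.
pose T := \matrix_(i, j) word_op (w i j); rewrite -/T.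
have formE (xi : 'I_n -> L2) : \sum_i \sum_j hdot (T i j (xi j)) (xi i) =
    \sum_i \sum_j hdot (word_op (w i j) (xi j)) (xi i).
  by apply: eq_bigr => i _; apply: eq_bigr => j _; rewrite mxE.
split=> [Tpos N f h|bpos xi].
  apply/os_cone_form => v; under eq_bigr do under eq_bigr do rewrite mxE.
  by rewrite -word_form -formE.
rewrite formE.
apply: (@cvg_ge0 _ _ totally _ (fun A => \sum_i \sum_j
   hdot (word_op (w i j) (trunc A (xi j))) (trunc A (xi i)))).
  apply: cvg_big => [|i _]; first exact: add_continuous.
  apply: cvg_big => [|j _]; first exact: add_continuous.
  apply: cvg_hdot; last exact: trunc_cvg.
  apply: continuous_cvg; first exact: word_op_continuous.
  exact: trunc_cvg.
(* The truncation of xi at A is the test vector of the block indexed by 'I_n * A. *)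
move=> A; pose I : finType := ('I_n * A)%type.
have truncI i : trunc A (xi i) =
    \sum_(a : I | a.1 == i) single (val a.2) (xi a.1 (val a.2)).
  transitivity (\sum_(x | x == i) \sum_(y : A) single (val y) (xi x (val y))).
    by rewrite big_pred1_eq /trunc big_seq_fsetE.
  by rewrite pair_big_dep; apply: eq_bigl => a; rewrite andbT.
under eq_bigr do under eq_bigr do rewrite !truncI.
rewrite word_form (reindex _ (onW_bij _ (@enum_val_bij I)))/=.
under eq_bigr do rewrite (reindex _ (onW_bij _ (@enum_val_bij I)))/=.
have /os_cone_form/(_ (fun a => xi (enum_val a).1 (val (enum_val a).2))) :=
  bpos #|{: I}| (fun a => (enum_val a).1) (fun a => val (enum_val a).2).
congr (_ <= _); apply: eq_bigr => a _; apply: eq_bigr => b _.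
by rewrite mxE.
Qed.

End CrossedProduct.

(** * The canonical isomorphism *)
Section Words.
Variables (R : realType) (S : operatorSystemType R) (G : groupType).
Variable X : dynamicalSystem S G.

Definition scale_word (k : R[i]) (w : seq (S * G)) : seq (S * G) :=
  [seq (k *: p.1, p.2) | p <- w].

Definition generator_word (w : seq (S * G)) : Prop :=
  forall p, p \in w -> ds_gen X p.2.

Lemma generator_word_cat w w' :
  generator_word w -> generator_word w' -> generator_word (w ++ w').
Proof. by move=> gw gw' p; rewrite mem_cat => /orP[/gw|/gw']. Qed.

Lemma generator_word_scale k w : generator_word w -> generator_word (scale_word k w).
Proof. by move=> gw _ /mapP[p /gw gp ->]. Qed.

Lemma generator_word1 x g : ds_gen X g -> generator_word [:: (x, g)].
Proof. by move=> gg p; rewrite inE => /eqP ->. Qed.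

Section Realization.
Variables (C : cstarAlgType R) (rho : S -> C) (alpha : cstarAction G C).
Variables (H : hilbertType R) (pi : starRep C H).
Hypothesis rho_coe :
  complete_order_embedding (@os_cone R S) (@cstar_cone R C) setT rho.
Hypothesis adm : admissible X rho alpha.
Hypothesis pi_inj : faithful pi.
Local Notation op := (word_op rho alpha pi).

Lemma word_op_cat w w' : op (w ++ w') = op w + op w'.
Proof. by rewrite /word_op big_cat. Qed.

Lemma word_op1 x g : op [:: (x, g)] = pi_tilde alpha pi (rho x) \o lambda (H := H) g.
Proof. by rewrite /word_op big_seq1. Qed.

Lemma rhoZ (k : R[i]) x : rho (k *: x) = k *: rho x.
Proof.
have lin a y z : rho (a *: y + z) = a *: rho y + rho z by exact: (coe_linear rho_coe).
have r0 : rho 0 = 0 by have := lin (-1) 0 0; rewrite !scaleN1r !addNr.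
by have := lin k x 0; rewrite r0 !addr0.
Qed.

Lemma word_op_scale k w : op (scale_word k w) = k *: op w.
Proof.
apply/funext => xi; apply: ell2_ext => h.
have -> : (k *: op w) xi = k *: op w xi by [].
rewrite ell2ZE !word_opE big_map scaler_sumr; apply: eq_bigr => p _ /=.
by rewrite rhoZ; exact: (repZ (rep_act alpha pi h^-1%g)).
Qed.

Lemma reduced_crossed_product_words :
  reduced_crossed_product alpha pi X rho = [set op w | w in generator_word].
Proof.
apply/seteqP; split=> [T [n [k [v [hv ->]]]]|_ [w gw <-]].
  have /choice[p hp] : forall i, exists p : S * G, ds_gen X p.2 /\
      v i = pi_tilde alpha pi (rho p.1) \o lambda (H := H) p.2.
    by move=> i; have [x [g [gg ->]]] := hv i; exists (x, g).
  exists (flatten [seq scale_word (k i) [:: p i] | i <- enum 'I_n]).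
    move=> r /flattenP[s /mapP[i _ ->]]; rewrite inE => /eqP -> /=.
    by have [] := hp i.
  rewrite -[RHS]big_enum/=; elim: (enum 'I_n) => [|i s ih] /=.
    by rewrite big_nil /word_op big_nil.
  rewrite big_cons -ih -cat1s word_op_cat; congr (_ + _).
  by rewrite (word_op_scale (k i) [:: p i]) (hp i).2; case: (p i) => x g; rewrite word_op1.
exists (size w), (fun=> 1), (fun i => op [:: nth (0, 1%g) w i]); split=> [i|].
  have gi := gw _ (mem_nth (0, 1%g) (ltn_ord i)).
  by case: (nth _ _ _) gi => x g gg; exists x, g; rewrite word_op1.
rewrite {1}/word_op (big_nth (0, 1%g)) big_mkord; apply: eq_bigr => i _.
by rewrite scale1r /word_op big_seq1.
Qed.

(** An operator with a vanishing quadratic form is zero, and the form vanishes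
    when it has both signs. *)
Lemma word_op_eq0 w : op w = 0 <->
  word_pos X (fun _ _ : 'I_1 => w) /\ word_pos X (fun _ _ : 'I_1 => scale_word (-1) w).
Proof.
rewrite -!(op_cone_word_op rho_coe adm pi_inj); split=> [w0|[wp wn]].
  split=> xi; rewrite sumr_ge0// => i _; rewrite sumr_ge0// => j _;
    rewrite mxE ?word_op_scale w0 ?scaler0;
    by rewrite (_ : (0 : ell2 G H -> ell2 G H) (xi j) = 0)// -(scale0r (0 : ell2 G H)) hdotZl mul0r.
apply/funext; apply: form_eq0; first exact: word_op_linear.
move=> xi; have := wp (fun=> xi); have := wn (fun=> xi).
rewrite !big_ord1 !mxE word_op_scale.
have -> : (-1 *: op w) xi = - op w xi by exact: scaleN1r.
by rewrite hdotNl oppr_ge0 => h1 h2; apply/eqP; rewrite eq_le h1 h2.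
Qed.

Lemma word_op_unit : rho os_unit = 1 -> op [:: (os_unit, 1%g)] = idfun.
Proof.
move=> u1; apply/funext => xi; apply: ell2_ext => h.
by rewrite word_opE big_seq1 /= u1 invg1 mul1g; exact: (rep_act1 alpha pi).
Qed.

End Realization.

Section TwoCovers.
Variables (C1 C2 : cstarAlgType R) (rho1 : S -> C1) (rho2 : S -> C2).
Variables (alpha1 : cstarAction G C1) (alpha2 : cstarAction G C2).
Variables (H1 H2 : hilbertType R) (pi1 : starRep C1 H1) (pi2 : starRep C2 H2).
Hypothesis coe1 :
  complete_order_embedding (@os_cone R S) (@cstar_cone R C1) setT rho1.
Hypothesis coe2 :
  complete_order_embedding (@os_cone R S) (@cstar_cone R C2) setT rho2.
Hypotheses (adm1 : admissible X rho1 alpha1) (adm2 : admissible X rho2 alpha2).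
Hypotheses (inj1 : faithful pi1) (inj2 : faithful pi2).
Local Notation op1 := (word_op rho1 alpha1 pi1).
Local Notation op2 := (word_op rho2 alpha2 pi2).

(** The criterion for the vanishing of a word does not involve the cover, so two
    words represent the same operator for one cover exactly when they do for the
    other. *)
Lemma word_op_eq w w' : op1 w = op1 w' <-> op2 w = op2 w'.
Proof.
have sub1 : op1 (w ++ scale_word (-1) w') = op1 w - op1 w'.
  by rewrite word_op_cat (word_op_scale _ _ coe1) scaleN1r.
have sub2 : op2 (w ++ scale_word (-1) w') = op2 w - op2 w'.
  by rewrite word_op_cat (word_op_scale _ _ coe2) scaleN1r.
have iff0 u : op1 u = 0 <-> op2 u = 0.
  by rewrite (word_op_eq0 coe1 adm1 inj1) (word_op_eq0 coe2 adm2 inj2).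
split=> /eqP; rewrite -subr_eq0 => /eqP h; apply/eqP; rewrite -subr_eq0; apply/eqP.
  by rewrite -sub2; apply/iff0; rewrite sub1.
by rewrite -sub1; apply/iff0; rewrite sub2.
Qed.

(** A word is chosen for each operator in the first crossed product. Off the
    crossed product the default is the empty word, which gives zero. *)
Definition canonical_map (T : ell2 G H1 -> ell2 G H1) : ell2 G H2 -> ell2 G H2 :=
  op2 (xget [::] [set w | generator_word w /\ op1 w = T]).

Lemma canonical_mapE w : generator_word w -> canonical_map (op1 w) = op2 w.
Proof.
move=> gw; apply/word_op_eq; rewrite /canonical_map.
by case: xgetP => [u _ [] //|/(_ w)]; case.
Qed.

Lemma canonical_map_coi : complete_order_iso
  (@op_cone R (ell2 G H1)) (@op_cone R (ell2 G H2))
  (reduced_crossed_product alpha1 pi1 X rho1)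
  (reduced_crossed_product alpha2 pi2 X rho2) canonical_map.
Proof.
rewrite (reduced_crossed_product_words _ _ coe1) (reduced_crossed_product_words _ _ coe2).
split; last first.
  apply/seteqP; split=> [_ [_ [w gw <-] <-]|_ [w gw <-]].
    by exists w => //; rewrite canonical_mapE.
  by exists (op1 w); [exists w | exact: canonical_mapE].
split.
- move=> k _ _ [w gw <-] [w' gw' <-].
  rewrite -(word_op_scale _ _ coe1) -word_op_cat !canonical_mapE//.
    by rewrite word_op_cat (word_op_scale _ _ coe2).
  exact/generator_word_cat/gw'/generator_word_scale.
- by move=> _ _ [w gw <-] [w' gw' <-]; rewrite !canonical_mapE// => /word_op_eq.
move=> n T hT.
have /choice[w hw] : forall ij : 'I_n * 'I_n, exists w,
    generator_word w /\ op1 w = T ij.1 ij.2.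
  by move=> [i j]; have [w gw wE] := hT i j; exists w.
have -> : T = \matrix_(i, j) op1 (w (i, j)).
  by apply/matrixP => i j; rewrite mxE (hw (i, j)).2.
have -> : map_mx canonical_map (\matrix_(i, j) op1 (w (i, j))) =
    \matrix_(i, j) op2 (w (i, j)).
  by apply/matrixP => i j; rewrite !mxE canonical_mapE//; exact: (hw (i, j)).1.
by rewrite (op_cone_word_op coe1 adm1 inj1) (op_cone_word_op coe2 adm2 inj2).
Qed.

Hypotheses (unit1 : rho1 os_unit = 1) (unit2 : rho2 os_unit = 1).

Lemma embeddings_canonically_isomorphic :
  canonically_isomorphic X rho1 alpha1 pi1 rho2 alpha2 pi2.
Proof.
exists canonical_map; split; first exact: canonical_map_coi.
  rewrite -(word_op_unit alpha1 pi1 unit1) -(word_op_unit alpha2 pi2 unit2).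
  exact/canonical_mapE/generator_word1/ds_gen1.
move=> x g gg; rewrite -!word_op1.
exact/canonical_mapE/generator_word1.
Qed.

End TwoCovers.
End Words.

(** * Quotients by a boundary ideal *)
Section Quotient.
Variables (R : realType) (S : operatorSystemType R).
Variables (C : cstarAlgType R) (rho : S -> C) (J : set C).

Lemma star_morphismB (A B : cstarAlgType R) (f : A -> B) : star_morphism f ->
  {morph f : x y / x - y}.
Proof.
by move=> /star_morphism_linear fl x y; have := fl (-1) y x;
  rewrite !scaleN1r ![- _ + _]addrC.
Qed.

Lemma quotient_map_eq (D : cstarAlgType R) (q : C -> D) : quotient_map J q ->
  forall x y, q x = q y <-> J (x - y).
Proof.
move=> qq x y; rewrite -(qm_ker qq) (star_morphismB (qm_morphism qq)).
by split=> [->|/eqP]; rewrite ?subrr// subr_eq0 => /eqP.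
Qed.

Lemma quotient_mul_adj (D : cstarAlgType R) (q : C -> D) n (Z : 'M[C]_n) :
  quotient_map J q ->
  map_mx q (adjmx star Z *m Z) = adjmx star (map_mx q Z) *m map_mx q Z.
Proof.
move=> qq; have qm := qm_morphism qq.
have q0 : q 0 = 0 by have := star_morphismB qm 0 0; rewrite !subrr.
have qD x y : q (x + y) = q x + q y.
  by have := star_morphism_linear qm 1 x y; rewrite !scale1r.
apply/matrixP => i j; rewrite !mxE (big_morph q qD q0); apply: eq_bigr => k _.
by rewrite !mxE (star_morphism_monoid qm).2 (star_morphism_star qm).
Qed.

(** If q(Y) = Z* Z, lift the entries of Z to C; then Y - Z* Z has entries in J,
    and q' kills it as well. *)
Lemma quotient_cone (D D' : cstarAlgType R) (q : C -> D) (q' : C -> D')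
    n (Y : 'M[C]_n) : quotient_map J q -> quotient_map J q' ->
  cstar_cone (map_mx q Y) -> cstar_cone (map_mx q' Y).
Proof.
move=> qq qq' [Z hZ].
have /choice[s qs] := qm_surj qq.
exists (map_mx q' (map_mx s Z)).
have sZ : map_mx q (map_mx s Z) = Z by apply/matrixP => i j; rewrite !mxE qs.
rewrite -(quotient_mul_adj _ qq'); apply/matrixP => i j.
rewrite [LHS]mxE [RHS]mxE; apply/(quotient_map_eq qq')/(quotient_map_eq qq).
have /matrixP/(_ i j) : map_mx q Y = map_mx q (adjmx star (map_mx s Z) *m map_mx s Z).
  by rewrite hZ quotient_mul_adj// sZ.
by rewrite [LHS]mxE [RHS]mxE.
Qed.

(** A boundary ideal provides one quotient that embeds rho(S); the cones and the
    kernel of any other quotient by the same ideal agree with those of that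
    one. *)
Lemma boundary_quotient_coe (D : cstarAlgType R) (q : C -> D) :
  complete_order_embedding (@os_cone R S) (@cstar_cone R C) setT rho ->
  boundary_ideal rho J -> quotient_map J q ->
  complete_order_embedding (@os_cone R S) (@cstar_cone R D) setT (fun x => q (rho x)).
Proof.
move=> coe [_ [D' [q' [qq' coe']]]] qq; split.
- move=> k x y _ _; rewrite (coe_linear coe)//.
  exact: star_morphism_linear (qm_morphism qq) _ _ _.
- move=> x y _ _ /(quotient_map_eq qq)/(quotient_map_eq qq') e.
  by apply: (coe_inj coe) => //; apply: (coe_inj coe') e; exists x + exists y.
move=> n Y _; rewrite (coe_cone coe)// (coe_cone coe'); last first.
  by move=> i j; rewrite mxE; exists (Y i j).
rewrite (_ : map_mx (fun x => q (rho x)) Y = map_mx q (map_mx rho Y)).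
  by split; exact: quotient_cone.
by apply/matrixP => i j; rewrite !mxE.
Qed.

End Quotient.

Theorem theorem3p24 (R : realType) (S : operatorSystemType R) (G : groupType)
    (X : dynamicalSystem S G)
    (C : cstarAlgType R) (rho : S -> C) (alpha : cstarAction G C)
    (rho_cover : cstar_cover rho) (alpha_adm : admissible X rho alpha)
    (J : set C) (J_shilov : shilov_ideal rho J)
    (CJ : cstarAlgType R) (q : C -> CJ) (q_quo : quotient_map J q)
    (alphaJ : cstarAction G CJ)
    (alphaJE : forall (g : G) (x : C), alphaJ g (q x) = q (alpha g x))
    (H : hilbertType R) (pi : starRep C H) (pi_faithful : faithful pi)
    (HJ : hilbertType R) (piJ : starRep CJ HJ) (piJ_faithful : faithful piJ) :
  canonically_isomorphic X rho alpha pi (fun x => q (rho x)) alphaJ piJ /\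
  (forall (C' : cstarAlgType R) (rho' : S -> C') (alpha' : cstarAction G C')
      (H' : hilbertType R) (pi' : starRep C' H'),
    cstar_cover rho' -> admissible X rho' alpha' -> faithful pi' ->
    canonically_isomorphic X rho alpha pi rho' alpha' pi').
Proof.
have [coe unit _] := rho_cover.
split=> [|C' rho' alpha' H' pi' [coe' unit' _] adm' inj'].
  apply: embeddings_canonically_isomorphic => //.
  - exact: boundary_quotient_coe coe J_shilov.1 q_quo.
  - by move=> g x; rewrite alphaJE alpha_adm.
  - by rewrite unit; have [] := star_morphism_monoid (qm_morphism q_quo).
exact: embeddings_canonically_isomorphic.
Qed.
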